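(* Let $\Lambda$ be a finite measure on $[0,1]$ with $\Lambda(\{1\})=0$ and let $\nu(dx)=x^{-2}\Lambda(dx)$ (with the convention $1/0=\infty$). Suppose $\nu(\{0,1\})=0$, $\int_0^1x\,\nu(dx)<\infty$ and $\nu([0,1])=\infty$. Let $(\Pi_t)_{t\ge0}$ be the $\Lambda$-coalescent and let $N^a_t=|\{b\in\Pi_t:\mathrm{freq}(b)>0\}|$. Then for every fixed $t>0$, $\mathbb{P}[N^a_t=\infty]=1$.
   Context: For $n\in\mathbb{N}$, let $\iota_n$ be the restriction map from partitions of $\mathbb{N}$ to partitions of $\{1,\dots,n\}$. The $\Lambda$-coalescent is the Markov process $(\Pi_t)_{t\ge 0}$ with values in partitions of $\mathbb{N}$, started from the partition into singletons, such that for every $n$, $\iota_n(\Pi_t)$ is a Markov chain in which, whenever it has $i$ blocks, each particular $k$-tuple of blocks merges at rate $\lambda_{i,k}=\int_0^1x^{k-2}(1-x)^{i-k}\Lambda(dx)$, independently of other $k$-tuples. For $t>0$, $\Pi_t$ is exchangeable, so almost surely each block $b$ has asymptotic frequency $\mathrm{freq}(b)=\lim_{k\to\infty}|b\cap\{1,\dots,k\}|/k$. *)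

(* Defs.v *)
From HB Require Import structures.
From mathcomp Require Import all_boot all_order all_algebra.
From mathcomp Require Import all_classical all_reals all_analysis.
Set Implicit Arguments. Unset Strict Implicit. Unset Printing Implicit Defensive.
Import Order.TTheory GRing.Theory Num.Theory.
Import numFieldNormedType.Exports.
Local Open Scope classical_set_scope.
Local Open Scope ring_scope.

Section Defs.
Variable R : realType.

Definition dens2 (x : R) : \bar R := if x == 0 then +oo%E else (x ^- 2)%:E.

Definition nu (Lam : {finite_measure set R -> \bar R}) (A : set R) : \bar R :=
  (\int[Lam]_(x in A) dens2 x)%E.

Definition nu_first_moment (Lam : {finite_measure set R -> \bar R}) : \bar R :=
  (\int[Lam]_(x in `[0%R, 1%R]) (x%:E * dens2 x))%E.

Definition lam_rate (Lam : {finite_measure set R -> \bar R}) (i k : nat) : R :=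
  fine (\int[Lam]_(x in `[0%R, 1%R]) (x ^+ (k - 2) * (1 - x) ^+ (i - k))%:E)%E.

(* States of the restricted chain: sets of blocks of 'I_n (only partitions
   of 'I_n are ever reached). *)
Definition fstate (n : nat) := {set {set 'I_n}}.

Definition singletons_n (n : nat) : fstate n := [set [set i] | i : 'I_n]%SET.

(* restriction iota_n of a partition of nat given as an equivalence relation *)
Definition restr (n : nat) (Rel : nat -> nat -> bool) : fstate n :=
  [set [set j : 'I_n | Rel (val i) (val j)] | i : 'I_n]%SET.

Definition is_merge n (pi pi' : fstate n) : bool :=
  [exists S : {set {set 'I_n}},
     [&& S \subset pi, (1 < #|S|)%N & pi' == (pi :\: S) :|: [set finset.cover S]]%SET].

Definition Qrate (Lam : {finite_measure set R -> \bar R}) n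
  (pi pi' : fstate n) : R :=
  if finset.partition pi [set: 'I_n]%SET && is_merge pi pi'
  then lam_rate Lam #|pi| #|(pi :\: pi')%SET| else 0.

Definition Qgen (Lam : {finite_measure set R -> \bar R}) n
  (pi pi' : fstate n) : R :=
  if pi == pi' then - \sum_(s : fstate n | s != pi) Qrate Lam pi s
  else Qrate Lam pi pi'.

Fixpoint Qpow (Lam : {finite_measure set R -> \bar R}) n (k : nat)
  (pi pi' : fstate n) : R :=
  match k with
  | 0 => (pi == pi')%:R
  | k'.+1 => \sum_(s : fstate n) Qpow Lam k' pi s * Qgen Lam s pi'
  end.

Definition ptrans (Lam : {finite_measure set R -> \bar R}) n (t : R)
  (pi pi' : fstate n) : R :=
  limn (fun N : nat => \sum_(k < N) (t ^+ k / (k`!)%:R) * Qpow Lam k pi pi').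

(* Pi : time -> outcome -> partition of nat (as an equivalence relation)
   is a Lambda-coalescent under P: for every n, iota_n(Pi) is the Markov chain
   with generator Qgen started from singletons (finite-dim. distributions). *)
Definition is_Lambda_coalescent (Lam : {finite_measure set R -> \bar R})
  (d : measure_display) (T : measurableType d) (P : probability T R)
  (Pi : R -> T -> nat -> nat -> bool) : Prop :=
  (forall t w, 0 <= t -> equivalence_rel (Pi t w)) /\
  (forall t n (pi : fstate n), 0 <= t ->
      measurable [set w | restr n (Pi t w) = pi]) /\
  (forall n (k : nat) (ts : nat -> R) (pis : nat -> fstate n),
      ts 0 = 0 -> pis 0 = singletons_n n ->
      (forall i, (i < k)%N -> ts i <= ts i.+1) ->
      P (\bigcap_(i < k.+1) [set w | restr n (Pi (ts i) w) = pis i]) =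
      (\prod_(i < k) ptrans Lam (ts i.+1 - ts i) (pis i) (pis i.+1))%:E).

Definition pos_freq (b : set nat) : Prop :=
  exists2 l : R, 0 < l &
    (fun k : nat => (#|[set j : 'I_k | `[< b (val j) >]]%SET|%:R / k%:R : R))
      @ \oo --> l.

Definition Na_infinite (Rel : nat -> nat -> bool) : Prop :=
  infinite_set [set b : set nat |
    (exists i, b = [set j | Rel i j]) /\ pos_freq b].

End Defs.

(* Main.v *)
(** Only the law of the coalescent at the fixed time [t] matters.

    Restrict to [{1..n}] and let [K] and [s] be the numbers of non-singleton
    and singleton blocks.  A merger of a fraction [x] of the blocks that hits
    singletons only creates a new non-singleton block; these mergers have total
    rate tending to [+oo] with [s], since [nu] is infinite.  Conversely [K]
    can only decrease when existing non-singleton blocks take part in a merger,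
    and each of them does so at rate at most [mu = int x nu(dx) < +oo].  Hence
    the generator applied to [(m + 1 - K)^+] is at most [m mu] minus a rate
    that blows up with [s] on [{K <= m}], so that [P(K <= m) -> 0] as soon
    as [s] is large with high probability.  The latter follows from the
    generator applied to [- H_s] ([H] the harmonic numbers), which is at most
    [mu / h + 4 H_n Lambda(]1 - h, 1[)], negligible compared with [H_n].

    The law of the restrictions is invariant under relabelling, so for fixed
    [i] the events [i ~ k] are exchangeable: second moments along a polynomial
    grid give the almost sure existence of the frequency of the block of [i],
    and [P(i ~ j, |block of i in {1..n}| <= c) <= c / n] shows that it is
    positive unless the block is a singleton. *)
Require Import Defs.
From HB Require Import structures.
From mathcomp Require Import all_boot all_order all_algebra all_fingroup.
From mathcomp Require Import all_classical all_reals all_analysis.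
From mathcomp Require Import measurable_realfun.
From mathcomp Require Import ring lra zify.
Set Implicit Arguments. Unset Strict Implicit. Unset Printing Implicit Defensive.
Import Order.TTheory GRing.Theory Num.Theory.
Import numFieldNormedType.Exports.
Local Open Scope ring_scope.

(** * Merging blocks of a partition *)

Section Merge.
Import mathcomp.boot.fintype mathcomp.boot.finset.
Variable n : nat.
Implicit Types (pi S : fstate n).

Definition merge_blocks pi S : fstate n := (pi :\: S) :|: [set cover S].
Definition singleton_blocks pi : fstate n := [set B in pi | #|B| == 1%N].
Definition large_blocks pi : fstate n := [set B in pi | (1 < #|B|)%N].
Definition mergeable pi S := (S \subset pi) && (1 < #|S|)%N.

Lemma partition_card_gt0 pi B : partition pi [set: 'I_n] -> B \in pi -> (0 < #|B|)%N.
Proof.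
move=> /and3P[_ _ /negP n0] Bpi; rewrite card_gt0; apply/negP => /eqP B0.
by apply: n0; rewrite -B0.
Qed.

Lemma card_singleton_large pi : partition pi [set: 'I_n] ->
  (#|singleton_blocks pi| + #|large_blocks pi|)%N = #|pi|.
Proof.
move=> Ppi.
have -> : large_blocks pi = pi :\: singleton_blocks pi.
  apply/setP => B; rewrite !inE; case Bpi: (B \in pi) => //=.
  by have := partition_card_gt0 Ppi Bpi; case: #|B| => [//|[|k]].
have sub : singleton_blocks pi \subset pi by apply/subsetP => B; rewrite inE => /andP[].
by rewrite cardsD (setIidPr sub) subnKC // subset_leq_card.
Qed.

Lemma partition_disjoint pi B C : partition pi [set: 'I_n] -> B \in pi ->
  C \in pi -> B != C -> [disjoint B & C].
Proof. by move=> /and3P[_ /trivIsetP tr _]; exact: tr. Qed.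

Lemma cover_mergeable pi S : partition pi [set: 'I_n] -> mergeable pi S ->
  cover S \notin pi /\ (1 < #|cover S|)%N.
Proof.
move=> Ppi /andP[SP S1].
have [B [C [BS CS BC]]] : exists B C, [/\ B \in S, C \in S & B != C].
  move: S1 => /card_gt1P [B [C [? ? ?]]].
  by exists B, C.
have Bp := subsetP SP _ BS; have Cp := subsetP SP _ CS.
have BsubS : B \subset cover S by exact: bigcup_sup.
have CsubS : C \subset cover S by exact: bigcup_sup.
have dBC : [disjoint B & C] by apply: partition_disjoint Ppi _ _ _ => //.
have B0 := partition_card_gt0 Ppi Bp; have C0 := partition_card_gt0 Ppi Cp.
split.
  apply/negP => cp.
  have key D E : D \in S -> E \in S -> D != E -> D \in pi -> E \in pi ->
     D \subset cover S -> (0 < #|D|)%N -> cover S = D.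
    move=> DS ES DE Dp Ep Dsub D0; apply/eqP; apply: contraT => cD.
    have := partition_disjoint Ppi cp Dp cD.
    rewrite disjoint_sym => /disjoint_setI0; rewrite (setIidPl Dsub) => D00.
    by move: D0; rewrite D00 cards0.
  have e1 := key B C BS CS BC Bp Cp BsubS B0.
  have e2 := key C B CS BS (negbT (contraNF (fun e => etrans (eq_sym _ _) e) BC)) Cp Bp CsubS C0.
  by move: BC; rewrite -e1 -{1}e2 eqxx.
have : (#|B :|: C| <= #|cover S|)%N by apply: subset_leq_card; rewrite subUset BsubS.
move: dBC => /disjoint_setI0 dBC.
by rewrite cardsU dBC cards0 subn0; apply: leq_trans; rewrite -addn1 leq_add.
Qed.

Lemma merge_blocksK pi S : partition pi [set: 'I_n] -> mergeable pi S ->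
  pi :\: merge_blocks pi S = S.
Proof.
move=> Ppi mS; have [/negP cS _] := cover_mergeable Ppi mS.
move: mS => /andP[SP _].
apply/setP => B; rewrite !inE; case: (boolP (B \in S)) => BS /=.
  rewrite (subsetP SP) // andbT; apply/negP => /eqP BE; apply: cS.
  by rewrite -BE (subsetP SP).
rewrite negb_or; case Bp : (B \in pi) => //=; last by rewrite andbF.
Qed.

Lemma card_large_merge pi S : partition pi [set: 'I_n] -> mergeable pi S ->
  #|large_blocks (merge_blocks pi S)| = (#|large_blocks pi| - #|S :&: large_blocks pi|).+1.
Proof.
move=> Ppi mS; have [cS c1] := cover_mergeable Ppi mS.
have -> : large_blocks (merge_blocks pi S) = cover S |: (large_blocks pi :\: S).
  apply/setP => B; rewrite !inE.
  by case: eqP => [->|_] /=; rewrite ?orbT ?c1 // orbF andbA.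
by rewrite cardsU1 !inE (negbTE cS) /= andbF add1n cardsD setIC.
Qed.

Lemma card_singleton_merge pi S : partition pi [set: 'I_n] -> mergeable pi S ->
  #|singleton_blocks (merge_blocks pi S)| = (#|singleton_blocks pi| - #|S :&: singleton_blocks pi|)%N.
Proof.
move=> Ppi mS; have [cS c1] := cover_mergeable Ppi mS.
have -> : singleton_blocks (merge_blocks pi S) = singleton_blocks pi :\: S.
  apply/setP => B; rewrite !inE.
  case: eqP => [->|_] /=; last by rewrite orbF andbA.
  by rewrite orbT (negbTE cS) /= andbF gtn_eqF.
by rewrite cardsD setIC.
Qed.

End Merge.

Section Drift.
Import mathcomp.boot.fintype mathcomp.boot.finset.
Variables (R : realType) (Lam : {finite_measure set R -> \bar R}) (n : nat).
Implicit Types (pi S : fstate n) (f : fstate n -> R).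

Definition Qfun f pi : R := \sum_(s : fstate n) Qgen Lam pi s * f s.

Lemma Qrate_merge pi S : partition pi [set: 'I_n] -> mergeable pi S ->
  Qrate Lam pi (merge_blocks pi S) = lam_rate Lam #|pi| #|S|.
Proof.
move=> Ppi mS; rewrite /Qrate Ppi merge_blocksK //=.
suff -> : is_merge pi (merge_blocks pi S) by [].
by apply/existsP; exists S; move: mS => /andP[-> ->] /=.
Qed.

Lemma QfunE f pi : partition pi [set: 'I_n] ->
  Qfun f pi = \sum_(S | mergeable pi S) lam_rate Lam #|pi| #|S| * (f (merge_blocks pi S) - f pi).
Proof.
move=> Ppi.
have -> : Qfun f pi = \sum_(s | s != pi) Qrate Lam pi s * (f s - f pi).
  rewrite /Qfun (bigD1 pi) //= {1}/Qgen eqxx mulNr addrC.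
  rewrite big_distrl /= -sumrB; apply: eq_bigr => s sp.
  by rewrite /Qgen eq_sym (negbTE sp) mulrBr.
rewrite (bigID (is_merge pi)) /= [X in _ + X]big1 ?addr0; last first.
  by move=> s /andP[_ /negbTE ns]; rewrite /Qrate ns andbF mul0r.
rewrite (reindex_onto (merge_blocks pi) (fun s => pi :\: s)) /=; last first.
  move=> s /andP[_ /existsP[S /and3P[SP S1 /eqP ->]]].
  by rewrite -/(merge_blocks pi S) merge_blocksK // /mergeable SP.
rewrite [LHS](_ : _ = \sum_(S | mergeable pi S) Qrate Lam pi (merge_blocks pi S) * (f (merge_blocks pi S) - f pi)).
  by apply: eq_bigr => S mS; rewrite Qrate_merge.
apply: eq_bigl => S; apply/idP/idP => [/andP[/andP[_ /existsP[S' /and3P[SP S1 /eqP e]]] /eqP e2]|mS].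
  have m' : mergeable pi S' by rewrite /mergeable SP.
  by rewrite -e2 e -/(merge_blocks pi S') merge_blocksK.
rewrite merge_blocksK // eqxx andbT; apply/andP; split; last first.
  by apply/existsP; exists S; move: mS => /andP[-> ->] /=.
have [cS _] := cover_mergeable Ppi mS.
by apply: contraNneq cS => <-; rewrite !inE eqxx orbT.
Qed.

End Drift.

(** * The semigroup of the restricted chain *)

Section Semigroup.
Local Open Scope classical_set_scope.
Variables (R : realType) (Lam : {finite_measure set R -> \bar R}) (n : nat).
Implicit Types (pi s : fstate n) (f g : fstate n -> R).

Definition pow_fun pi f (k : nat) : R := \sum_s Qpow Lam k pi s * f s.

Definition chain_mean pi f (t : R) : R :=
  limn (pseries (fun k => pow_fun pi f k / k`!%:R) t).

Lemma pow_fun0 pi f : pow_fun pi f 0 = f pi.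
Proof.
rewrite /pow_fun (bigD1 pi) //= eqxx mul1r big1 ?addr0 // => s sp.
by rewrite eq_sym (negbTE sp) mul0r.
Qed.

Lemma pow_funS pi f k : pow_fun pi f k.+1 = pow_fun pi (Qfun Lam f) k.
Proof.
rewrite /pow_fun /=; under eq_bigr do rewrite big_distrl /=.
rewrite exchange_big /=; apply: eq_bigr => s _.
by rewrite /Qfun big_distrr /=; apply: eq_bigr => s' _; rewrite mulrA.
Qed.

Let C : R := \sum_s \sum_(s' : fstate n) `|Qgen Lam s s'|.

Let C_ge0 : 0 <= C.
Proof. by do 2![apply: sumr_ge0 => ? _]. Qed.

Let Qfun_bound f (b : R) : (forall s, `|f s| <= b) -> forall s, `|Qfun Lam f s| <= C * b.
Proof.
move=> fb s; have b0 : 0 <= b by apply: le_trans (fb s).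
apply: (le_trans (ler_norm_sum _ _ _)).
apply: (@le_trans _ _ (\sum_(s' : fstate n) `|Qgen Lam s s'| * b)).
  by apply: ler_sum => s' _; rewrite normrM ler_wpM2l.
rewrite -big_distrl /= ler_wpM2r // /C [leRHS](bigD1 s) //= lerDl.
by do 2![apply: sumr_ge0 => ? _].
Qed.

Let pow_fun_bound pi k : forall f (b : R), (forall s, `|f s| <= b) ->
  `|pow_fun pi f k| <= C ^+ k * b.
Proof.
elim: k => [|k IH] f b fb; first by rewrite pow_fun0 expr0 mul1r.
by rewrite pow_funS exprSr -mulrA; apply: IH => s; exact: Qfun_bound.
Qed.

Lemma is_cvg_chain_mean pi f t : cvgn (pseries (fun k => pow_fun pi f k / k`!%:R) t).
Proof.
pose b := \sum_s `|f s|.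
have fb s : `|f s| <= b.
  by rewrite /b (bigD1 s) //= lerDl; apply: sumr_ge0.
have b0 : 0 <= b by apply: sumr_ge0.
apply: normed_cvg.
apply: (@series_le_cvg _ _ (fun k => b * exp_coeff (C * `|t|) k)) => [k|k|k|].
- by rewrite /=.
- by rewrite /= mulr_ge0 // divr_ge0 ?exprn_ge0 ?mulr_ge0.
- rewrite /= !normrM normfV (ger0_norm (ler0n _ _)) normrX /exp_coeff /=.
  rewrite exprMn mulrAC !mulrA ler_wpM2r ?invr_ge0 ?ler0n //.
  by rewrite ler_wpM2r ?exprn_ge0 // [b * _]mulrC pow_fun_bound.
- by apply: is_cvg_seriesZ; exact: is_cvg_series_exp_coeff.
Qed.

Lemma is_derive_chain_mean pi f t : is_derive t (1 : R) (chain_mean pi f) (chain_mean pi (Qfun Lam f) t).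
Proof.
have dE g : pseries_diffs (fun k => pow_fun pi g k / k`!%:R) =
    (fun k => pow_fun pi (Qfun Lam g) k / k`!%:R).
  apply/funext => k; rewrite /pseries_diffs pow_funS factS natrM invfM.
  by rewrite mulrCA mulVKf.
have := @pseries_snd_diffs R (fun k => pow_fun pi f k / k`!%:R) (`|t| + 1) t.
rewrite !dE; apply; try exact: is_cvg_chain_mean.
by rewrite [ltRHS]ger0_norm ?ltrDl// addr_ge0.
Qed.

Lemma chain_mean0 pi f : chain_mean pi f 0 = f pi.
Proof.
apply: cvg_lim => //; apply: cvg_near_cst; near=> N.
have N0 : (0 < N)%N by near: N; exists 1%N.
rewrite /pseries /series /= -(prednK N0) big_nat_recl // big1 ?addr0.
  by rewrite fact0 divr1 expr0 mulr1 pow_fun0.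
by move=> k _; rewrite expr0n mulr0.
Unshelve. all: by end_near. Qed.

Lemma chain_meanE pi f t : chain_mean pi f t = \sum_s ptrans Lam t pi s * f s.
Proof.
have pE s : ptrans Lam t pi s = chain_mean pi (fun s' => (s == s')%:R) t.
  congr lim; apply: f_equal2 => //.
  apply/funext => N; rewrite /pseries /series /= big_mkord; apply: eq_bigr => k _.
  rewrite /pow_fun (bigD1 s) //= eqxx mulr1 big1 ?addr0; last first.
    by move=> s' ss'; rewrite eq_sym (negbTE ss') mulr0.
  by rewrite mulrC -mulrA [_ ^+ _ / _]mulrC.
apply: cvg_lim => //; under eq_bigr do rewrite pE.
have -> : pseries (fun k => pow_fun pi f k / k`!%:R) t = (fun N => \sum_s
    pseries (fun k => pow_fun pi (fun s' => (s == s')%:R) k / k`!%:R) t N * f s).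
  apply/funext => N; rewrite /pseries /series /=.
  under [RHS]eq_bigr do rewrite big_distrl /=.
  rewrite exchange_big /=; apply: eq_bigr => k _.
  under [RHS]eq_bigr do rewrite mulrAC.
  rewrite -big_distrl /=; congr (_ * _).
  under [RHS]eq_bigr do rewrite mulrAC.
  rewrite -big_distrl /=; congr (_ * _).
  rewrite [LHS]/pow_fun; apply: eq_bigr => s _; congr (_ * _).
  rewrite /pow_fun (bigD1 s) //= eqxx mulr1 big1 ?addr0 //.
  by move=> s' ss'; rewrite eq_sym (negbTE ss') mulr0.
apply: cvg_big => // [|s _]; first by apply: add_continuous.
apply: cvgMl; exact: is_cvg_chain_mean.
Qed.

End Semigroup.

Section Comparison.
Local Open Scope classical_set_scope.
Variable R : realType.

Lemma derive_le_linear (y dy : R -> R) (a t : R) : 0 <= t ->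
  (forall u, is_derive u (1 : R) y (dy u)) ->
  (forall u, 0 <= u <= t -> dy u <= a) -> y t <= y 0 + a * t.
Proof.
move=> t0 dyP dya.
have [->|tn0] := eqVneq t 0; first by rewrite mulr0 addr0.
have tp : 0 < t by rewrite lt_def tn0.
have yc : {within `[0, t], continuous y}.
  apply: continuous_subspaceT => u; apply: differentiable_continuous.
  by apply/derivable1_diffP; have := dyP u => -[].
have [c cI ->] : exists2 c, c \in `]0, t[%R & y t = y 0 + dy c * t.
  have [c cI e] := MVT tp (fun x _ => dyP x) yc.
  by exists c => //; rewrite -[t in _ * t]subr0 -e addrC subrK.
rewrite lerD2l ler_wpM2r // dya //.
by move: cI; rewrite in_itv /= => /andP[/ltW -> /ltW ->].
Qed.

Lemma derive_le_relax (y dy : R -> R) (a L t : R) : 0 < t -> 0 < L ->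
  (forall u, is_derive u (1 : R) y (dy u)) ->
  (forall u, 0 <= u <= t -> dy u <= a - L * y u) -> 0 <= y 0 -> 0 <= a ->
  y t <= y 0 / (L * t) + a / L.
Proof.
move=> t0 L0 dyP dya y0 a0.
pose z u := expR (L * u) * (y u - a / L).
have dz u : is_derive u (1 : R) z (expR (L * u) * (dy u - (a - L * y u))).
  have dyu := dyP u.
  have dL : is_derive u (1:R) (fun v => expR (L * v)) (expR (L * u) * L).
    have dl : is_derive u (1:R) (fun v : R => L * v) (L * 1).
      exact: (is_deriveZ L (is_derive_id u (1:R))).
    rewrite -[L in _ * L]mulr1.
    exact: (is_derive1_comp (is_derive_expR (L * u)) dl).
  have dB : is_derive u (1:R) (fun v => y v - a / L) (dy u - 0).
    exact: (is_deriveB (dyP u) (is_derive_cst (a / L) u (1:R))).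
  apply: is_derive_eq (is_deriveM dL dB) _.
  rewrite /GRing.scale /= subr0 [X in _ + X]mulrC -mulrA -mulrDr; congr (_ * _).
  by rewrite mulrBr mulrCA divff ?gt_eqF // mulr1 opprB.
have := @derive_le_linear z _ 0 t (ltW t0) dz.
rewrite mul0r addr0 /z mulr0 expR0 mul1r => /(_ _)/wrap[].
  by move=> u ut; rewrite pmulr_rle0 ?expR_gt0 // subr_le0 dya.
move=> h; rewrite -lerBlDr.
have e1 : L * t <= expR (L * t) by apply: le_trans (expR_ge1Dx _); rewrite lerDr.
have Lt0 : 0 < L * t by rewrite mulr_gt0.
have [yneg|ypos] := leP (y t - a / L) 0.
  by apply: le_trans yneg _; rewrite divr_ge0 ?(ltW Lt0).
rewrite ler_pdivlMr // mulrC.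
apply: (le_trans (_ : _ <= expR (L * t) * (y t - a / L))).
  by rewrite ler_pM2r.
by apply: le_trans h _; rewrite gerDl oppr_le0 divr_ge0 // ltW.
Qed.

End Comparison.

(** * Binomial random subsets *)

Section BinomialSubset.
Import mathcomp.boot.fintype mathcomp.boot.finset.
Variables (R : realType) (T : finType).
Implicit Types (A D S : {set T}) (x : R).

Definition bern A x S : R := x ^+ #|S| * (1 - x) ^+ (#|A| - #|S|).

Lemma sum_subset_card (V : nmodType) A (F : nat -> V) :
  \sum_(S : {set T} | S \subset A) F #|S| = \sum_(k < #|A|.+1) F k *+ 'C(#|A|, k).
Proof.
rewrite (partition_big (fun S : {set T} => inord #|S| : 'I_#|A|.+1) xpredT) //=.
apply: eq_bigr => k _.
rewrite -cards_draws -sumr_const.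
rewrite [RHS](eq_bigr (fun S : {set T} => F #|S|)); last first.
  by move=> S; rewrite inE => /andP[_ /eqP ->].
apply: eq_bigl => S; rewrite inE; case SA: (S \subset A) => //=.
by rewrite -val_eqE /= inordK // ltnS subset_leq_card.
Qed.

Lemma sum_bern A x : \sum_(S : {set T} | S \subset A) bern A x S = 1.
Proof.
rewrite (sum_subset_card A (fun k => x ^+ k * (1 - x) ^+ (#|A| - k))).
rewrite -[RHS](expr1n R #|A|) -[X in X ^+ #|A|](subrK x 1) exprDn.
by apply: eq_bigr => k _; rewrite [x ^+ _ * _]mulrC.
Qed.

Lemma bern_ge0 A x S : 0 <= x <= 1 -> 0 <= bern A x S.
Proof. by move=> /andP[x0 x1]; rewrite mulr_ge0 ?exprn_ge0 // subr_ge0. Qed.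

Lemma sum_bern_shift A i x (g : {set T} -> R) : i \in A -> x < 1 ->
  \sum_(S : {set T} | (S \subset A) && (i \in S)) bern A x S * g S =
  x / (1 - x) * \sum_(S : {set T} | (S \subset A) && (i \notin S)) bern A x S * g (i |: S).
Proof.
move=> iA x1.
rewrite (reindex_onto (fun S => i |: S) (fun S => S :\ i)) /=; last first.
  by move=> S /andP[_ iS]; rewrite setD1K.
rewrite big_distrr /=; apply: eq_big => [S|S].
  rewrite subUset sub1set iA /= setU11 andbT; case: (S \subset A) => //=.
  apply/eqP/idP => [<-|iS]; first by rewrite !inE eqxx.
  by rewrite setU1K.
move=> /andP[/andP[SA _] /eqP e].
have iS : i \notin S by rewrite -e !inE eqxx.
rewrite mulrA; congr (_ * _); rewrite /bern cardsU1 iS add1n exprS.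
have lt : (#|S| < #|A|)%N.
  by move: SA => /subset_leq_card; rewrite cardsU1 iS.
rewrite -[(#|A| - #|S|)%N]prednK ?subn_gt0 // exprS -subnS.
set a := x ^+ _; set c := (1 - x) ^+ _.
by field; rewrite subr_eq0 gt_eqF.
Qed.

Lemma sum_bern_mem A i x : i \in A -> x < 1 ->
  \sum_(S : {set T} | (S \subset A) && (i \in S)) bern A x S = x.
Proof.
move=> iA x1; set a := LHS.
pose b := \sum_(S : {set T} | (S \subset A) && (i \notin S)) bern A x S.
have a1 : a + b = 1.
  by rewrite -(sum_bern A x) [RHS](bigID (fun S : {set T} => i \in S)).
have ab : a = x / (1 - x) * b.
  have := sum_bern_shift (fun=> 1) iA x1.
  under eq_bigr do rewrite mulr1.
  by under [X in _ * X]eq_bigr do rewrite mulr1.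
have n0 : 1 - x != 0 by rewrite subr_eq0 gt_eqF.
have bE : b = 1 - a by rewrite -a1 addrAC subrr add0r.
move: ab => /(congr1 (fun z => z * (1 - x))); rewrite bE mulrAC divfK //.
lra.
Qed.

Lemma sum_bern_ratio A D x : D \subset A -> 0 <= x < 1 ->
  \sum_(S : {set T} | S \subset A) bern A x S *
     (#|S :&: D|%:R / (#|D| - #|S :&: D|).+1%:R) <= x / (1 - x).
Proof.
move=> DA /andP[x0 x1].
pose h S : R := (#|D| - #|S :&: D|).+1%:R^-1.
have -> : \sum_(S : {set T} | S \subset A) bern A x S *
     (#|S :&: D|%:R / (#|D| - #|S :&: D|).+1%:R) =
  \sum_(i in D) \sum_(S : {set T} | (S \subset A) && (i \in S)) bern A x S * h S.
  under [RHS]eq_bigr do rewrite big_mkcondr /=.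
  rewrite exchange_big /=; apply: eq_bigr => S SA.
  rewrite -/(h S) mulrCA -sum1_card natr_sum big_distrl /= big_mkcond [RHS]big_mkcond /=.
  by apply: eq_bigr => i _; rewrite inE mul1r; case: (i \in S); case: (i \in D).
have -> : \sum_(i in D) \sum_(S : {set T} | (S \subset A) && (i \in S)) bern A x S * h S =
  x / (1 - x) * \sum_(S : {set T} | S \subset A) bern A x S * \sum_(i in D | i \notin S) h (i |: S).
  rewrite (eq_bigr (fun i => x / (1 - x) *
    \sum_(S : {set T} | (S \subset A) && (i \notin S)) bern A x S * h (i |: S))); last first.
    by move=> i iD; rewrite sum_bern_shift // (subsetP DA).
  rewrite -big_distrr /=; congr (_ * _).
  under eq_bigr do rewrite big_mkcondr /=.
  rewrite exchange_big /=; apply: eq_bigr => S SA.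
  by rewrite big_distrr /= [RHS]big_mkcondr.
have y0 : 0 <= x / (1 - x) by rewrite divr_ge0 // subr_ge0 ltW.
rewrite -[leRHS]mulr1 ler_wpM2l // -(sum_bern A x); apply: ler_sum => S SA.
rewrite -[leRHS]mulr1 ler_wpM2l //; first by rewrite bern_ge0 // x0 ltW.
have hE i : i \in D -> i \notin S -> h (i |: S) = (#|D :\: S|)%:R^-1.
  move=> iD iS; congr (_%:R^-1).
  have -> : #|(i |: S) :&: D| = #|S :&: D|.+1.
    by rewrite setIUl (setIidPl _) ?sub1set // cardsU1 inE (negbTE iS).
  have lt : (#|S :&: D| < #|D|)%N.
    rewrite -subn_gt0 setIC -cardsD card_gt0; apply/set0Pn; exists i.
    by rewrite !inE iD iS.
  by rewrite subnSK // cardsD setIC.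
rewrite (eq_bigr (fun=> #|D :\: S|%:R^-1)); last by move=> i /andP[]; exact: hE.
rewrite sumr_const (_ : #|_| = #|D :\: S|); last first.
  by apply: eq_card => i; rewrite !inE andbC.
have [->|n0] := eqVneq #|D :\: S| 0%N; first by rewrite mulr0n ler01.
by rewrite -[_^-1 *+ _]mulr_natr mulVf // pnatr_eq0.
Qed.

Lemma sum_bern_gt1 D x :
  \sum_(S : {set T} | (S \subset D) && (1 < #|S|)%N) bern D x S =
  1 - (1 - x) ^+ #|D| - #|D|%:R * x * (1 - x) ^+ #|D|.-1.
Proof.
have := sum_bern D x.
rewrite (bigID (fun S : {set T} => (1 < #|S|)%N)) /= => e.
rewrite -{1}e -!addrA -[LHS]addr0; congr (_ + _).
rewrite -opprD; apply/esym/eqP; rewrite subr_eq0; apply/eqP.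
rewrite big_mkcondr /=.
under eq_bigr do rewrite -leqNgt.
rewrite (sum_subset_card D (fun k => if (k <= 1)%N then x ^+ k * (1 - x) ^+ (#|D| - k) else 0)).
rewrite big_ord_recl /= expr0 mul1r subn0 bin0 mulr1n; congr (_ + _).
case: #|D| => [|d]; first by rewrite big_ord0 !mul0r.
rewrite big_ord_recl /= big1 ?addr0; last by move=> i _; rewrite mul0rn.
by rewrite bin1 expr1 subn1 /= -[LHS]mulr_natl mulrA.
Qed.

End BinomialSubset.

Section Elementary.
Variable R : realType.

Lemma binomial_tail_bound (x : R) r : 0 < x <= 1 / 2%:R ->
  (1 - x) ^+ (2 * r) + (2 * r)%:R * x * (1 - x) ^+ (2 * r).-1 <= 4%:R / (1 + r%:R * x).
Proof.
move=> /andP[x0 x12].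
have q2 : 1 / 2%:R <= 1 - x by rewrite lerBrDr; apply: le_trans (lerD (lexx _) x12) _; rewrite -splitr.
have q0 : 0 < 1 - x by apply: lt_le_trans q2; rewrite divr_gt0.
have rx : 0 <= r%:R * x by rewrite mulr_ge0 // ltW.
rewrite ler_pdivlMr; last by rewrite ltr_wpDr.
have key : (1 - x) ^+ (2 * r) * (1 + r%:R * x) ^+ 2 <= 1.
  have bernoulli : 1 + r%:R * x <= (1 + x) ^+ r.
    elim: r {rx} => [|r IH]; first by rewrite mul0r addr0 expr0.
    rewrite exprSr; apply: le_trans (ler_wpM2r _ IH); last by rewrite addr_ge0 // ltW.
    have h : 0 <= r%:R * x * x by rewrite !mulr_ge0 // ltW.
    by rewrite -natr1; nra.
  rewrite mulnC exprM -exprMn exprn_ile1 //.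
    by rewrite mulr_ge0 ?exprn_ge0 ?(ltW q0) // addr_ge0.
  apply: (le_trans (ler_wpM2l (exprn_ge0 _ (ltW q0)) bernoulli)).
  rewrite -exprMn exprn_ile1 //; first by rewrite mulr_ge0 ?(ltW q0) ?addr_ge0 ?(ltW x0).
  by rewrite -subr_sqr expr1n gerDl oppr_le0 sqr_ge0.
have h1 : (1 - x) ^+ (2 * r) + (2 * r)%:R * x * (1 - x) ^+ (2 * r).-1 <=
    (1 - x) ^+ (2 * r) * (4%:R * (1 + r%:R * x)).
  case: r rx {key} => [|r] rx; first by rewrite muln0 expr0 !mul0r; lra.
  rewrite mulnS add2n -[(2 * r).+2.-1]/((2 * r).+1) exprS.
  set q := (1 - x) ^+ (2 * r).+1.
  have qp : 0 <= q by rewrite exprn_ge0 // ltW.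
  rewrite [(1 - x) * q]mulrC -!mulrA [X in _ + X](_ : _ = q * ((2 * r).+2%:R * x)); last by ring.
  rewrite -mulrDr ler_wpM2l //.
  have -> : (2 * r).+2%:R * x = 2%:R * (r.+1%:R * x) :> R by rewrite mulrA -natrM mulnS add2n.
  move: rx; set z := r.+1%:R * x => z0.
  nra.
have z0 : 0 <= 1 + r%:R * x by rewrite addr_ge0.
apply: (le_trans (ler_wpM2r z0 h1)).
rewrite -mulrA -mulrA -expr2 mulrCA -[leRHS]mulr1 ler_wpM2l //.
Qed.

End Elementary.

(** * Merger rates as integrals *)

Section Rates.
Local Open Scope classical_set_scope.
Variables (R : realType) (Lam : {finite_measure set R -> \bar R}).
Hypotheses (Lam0 : Lam [set 0] = 0%E) (Lam1 : Lam [set 1] = 0%E).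

Definition rate_density (b k : nat) (x : R) : R := x ^+ (k - 2) * (1 - x) ^+ (b - k).

Lemma rate_density_ge0 b k (x : R) : 0 <= x <= 1 -> 0 <= rate_density b k x.
Proof. by move=> /andP[x0 x1]; rewrite mulr_ge0 ?exprn_ge0 // subr_ge0. Qed.

Lemma rate_density_le1 b k (x : R) : 0 <= x <= 1 -> rate_density b k x <= 1.
Proof.
move=> /andP[x0 x1]; rewrite mulr_ile1 ?exprn_ge0 ?exprn_ile1 ?subr_ge0 //.
by rewrite gerBl.
Qed.

Lemma measurable_rate_density D b k : measurable_fun D (rate_density b k).
Proof.
apply: measurable_funTS; apply: measurable_funM; first exact: exprn_measurable.
by apply: measurable_funX; apply: measurable_funB.
Qed.

Lemma itv_oo01 (x : R) : `]0, 1[%classic x -> 0 < x < 1.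
Proof. by rewrite /= in_itv. Qed.

Lemma lam_rateE b k :
  (lam_rate Lam b k)%:E = (\int[Lam]_(x in `]0%R, 1%R[) (rate_density b k x)%:E)%E.
Proof.
have -> : `]0%R, 1%R[%classic = `[0%R, 1%R]%classic `\` ([set 0] `|` [set 1]) :> set R.
  apply/seteqP; split => x /=; rewrite !in_itv /=.
    by move=> /andP[x0 x1]; rewrite !ltW //; split => // -[] e; move: x0 x1; rewrite e ltxx.
  move=> [/andP[x0 x1] /not_orP[n0 n1]]; apply/andP; split.
    by rewrite lt_neqAle x0 andbT eq_sym; apply/eqP.
  by rewrite lt_neqAle x1 andbT; apply/eqP.
rewrite -ge0_negligible_integral //.
- rewrite /lam_rate fineK // ge0_fin_numE; last first.
    by apply: integral_ge0 => x /=; rewrite in_itv /= => x01; rewrite lee_fin rate_density_ge0.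
  apply: (@le_lt_trans _ _ (\int[Lam]_(x in `[0%R, 1%R]) (cst 1%E x))%E).
    apply: ge0_le_integral => //.
    + by move=> x /=; rewrite in_itv /= => x01; rewrite lee_fin rate_density_ge0.
    + by apply/measurable_EFinP; exact: measurable_rate_density.
    + by move=> x /=; rewrite in_itv /= => x01; rewrite lee_fin rate_density_le1.
  by rewrite integral_cst // mul1e ltey_eq fin_num_measure.
- exact: measurableU.
- by apply/measurable_EFinP; exact: measurable_rate_density.
- by move=> x /=; rewrite in_itv /= => x01; rewrite lee_fin rate_density_ge0.
- apply/eqP; rewrite eq_le measure_ge0 andbT.
  have := measureU2 Lam (measurable_set1 (0 : R)) (measurable_set1 (1 : R)).
  by rewrite [X in (_ <= X)%E -> _](_ : _ = 0%E) // -[RHS]add0e; congr (_ + _)%E.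
Qed.

Lemma lam_rate_sum (I : finType) (Pr : pred I) (c : I -> R) (k : I -> nat) b :
  (forall i, Pr i -> 0 <= c i) ->
  (\sum_(i | Pr i) lam_rate Lam b (k i) * c i)%:E =
  (\int[Lam]_(x in `]0%R, 1%R[) (\sum_(i | Pr i) rate_density b (k i) x * c i)%:E)%E.
Proof.
move=> c0; pose c' i := if Pr i then c i else 0.
have c'0 i : 0 <= c' i by rewrite /c'; case: ifP => // /c0.
have e (F : I -> R) : \sum_(i | Pr i) F i * c i = \sum_i F i * c' i.
  by rewrite big_mkcond; apply: eq_bigr => i _; rewrite /c'; case: ifP => //; rewrite mulr0.
rewrite e; under eq_integral do rewrite e -sumEFin.
rewrite ge0_integral_sum //.
- rewrite -sumEFin; apply: eq_bigr => i _.
  under eq_integral do rewrite EFinM.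
  rewrite ge0_integralZr //.
  + by rewrite -lam_rateE EFinM.
  + by apply/measurable_EFinP; exact: measurable_rate_density.
  + by move=> x /itv_oo01/andP[x0 x1]; rewrite lee_fin rate_density_ge0 // !ltW.
  + by rewrite lee_fin.
- move=> i; apply/measurable_EFinP; apply: measurable_funM => //.
  exact: measurable_rate_density.
- by move=> i x /itv_oo01/andP[x0 x1]; rewrite lee_fin mulr_ge0 // rate_density_ge0 // !ltW.
Qed.

Lemma measurable_rate_sum (I : finType) (Pr : pred I) (c : I -> R) (k : I -> nat) b D :
  measurable_fun D (fun x => (\sum_(i | Pr i) rate_density b (k i) x * c i)%:E).
Proof.
apply/measurable_EFinP.
under eq_fun do rewrite big_mkcond.
apply: measurable_sum => i; case: (Pr i) => //.
by apply: measurable_funM => //; exact: measurable_rate_density.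
Qed.

Lemma lam_rate_sum_le (I : finType) (Pr : pred I) (c : I -> R) (k : I -> nat) b
    (phi : R -> R) : (forall i, Pr i -> 0 <= c i) ->
  measurable_fun (`]0, 1[%classic : set R) phi ->
  (forall x, 0 < x < 1 -> \sum_(i | Pr i) rate_density b (k i) x * c i <= phi x) ->
  ((\sum_(i | Pr i) lam_rate Lam b (k i) * c i)%:E <=
   \int[Lam]_(x in `]0%R, 1%R[) (phi x)%:E)%E.
Proof.
move=> c0 mphi le; rewrite lam_rate_sum //; apply: ge0_le_integral => //.
- move=> x /itv_oo01/andP[x0 x1]; rewrite lee_fin; apply: sumr_ge0 => i /c0 ci.
  by rewrite mulr_ge0 // rate_density_ge0 // !ltW.
- exact: measurable_rate_sum.
- exact/measurable_EFinP.
Qed.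

Lemma lam_rate_sum_ge (I : finType) (Pr : pred I) (c : I -> R) (k : I -> nat) b
    (D : set R) (phi : R -> R) : (forall i, Pr i -> 0 <= c i) ->
  measurable D -> D `<=` `]0, 1[%classic ->
  measurable_fun D phi -> (forall x, D x -> 0 <= phi x) ->
  (forall x, D x -> phi x <= \sum_(i | Pr i) rate_density b (k i) x * c i) ->
  (\int[Lam]_(x in D) (phi x)%:E <=
   (\sum_(i | Pr i) lam_rate Lam b (k i) * c i)%:E)%E.
Proof.
move=> c0 mD sD mphi phi0 le; rewrite lam_rate_sum //.
apply: (@le_trans _ _ (\int[Lam]_(x in D) (\sum_(i | Pr i) rate_density b (k i) x * c i)%:E)%E).
  apply: ge0_le_integral => //.
  - exact/measurable_EFinP.
  - exact: measurable_rate_sum.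
apply: ge0_subset_integral => //; first exact: measurable_rate_sum.
move=> x /itv_oo01/andP[x0 x1]; rewrite lee_fin; apply: sumr_ge0 => i /c0 ci.
by rewrite mulr_ge0 // rate_density_ge0 // !ltW.
Qed.

Lemma measurable_invr_gt0 (D : set R) : measurable D -> D `<=` `]0, +oo[%classic ->
  measurable_fun D (fun x : R => x^-1).
Proof.
move=> mD sD; apply: (@measurable_funS _ _ _ _ (`]0, +oo[%classic : set R)) => //.
apply: open_continuous_measurable_fun => // x; rewrite inE /= in_itv /= andbT => x0.
by apply: inv_continuous; rewrite gt_eqF.
Qed.

Lemma measurable_invr_sqr_gt0 (D : set R) : measurable D -> D `<=` `]0, +oo[%classic ->
  measurable_fun D (fun x : R => x ^- 2).
Proof.
move=> mD sD; apply: (@eq_measurable_fun _ _ _ _ _ (fun x : R => (x^-1) ^+ 2)).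
  by move=> x _; rewrite exprVn.
by apply: measurable_funX; exact: measurable_invr_gt0.
Qed.

Lemma measurable_dens2 : measurable_fun (`[0, 1]%classic : set R) (@dens2 R).
Proof.
have -> : `[0, 1]%classic = [set 0] `|` `]0, 1]%classic :> set R.
  by rewrite setU1itv // bnd_simp.
apply/measurable_funU => //; split; first exact: measurable_fun_set1.
apply: (@eq_measurable_fun _ _ _ _ _ (fun x : R => (x ^- 2)%:E)).
  move=> x; rewrite inE /= in_itv /= => /andP[x0 _].
  by rewrite /dens2 gt_eqF.
apply/measurable_EFinP; apply: measurable_invr_sqr_gt0 => //.
by move=> x /=; rewrite !in_itv /= andbT => /andP[].
Qed.

Lemma dens2_ge0 x : (0 <= @dens2 R x)%E.
Proof. by rewrite /dens2; case: ifP => // _; rewrite lee_fin invr_ge0 sqr_ge0. Qed.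
#[local] Hint Resolve dens2_ge0 : core.

Lemma first_moment_int :
  (\int[Lam]_(x in `]0%R, 1%R[) (x^-1)%:E <= nu_first_moment Lam)%E.
Proof.
rewrite (eq_integral (fun x : R => (x%:E * dens2 x)%E)); last first.
  move=> x; rewrite inE => /itv_oo01/andP[x0 _].
  by rewrite /dens2 gt_eqF // -EFinM expr2 invfM mulVKf // gt_eqF.
apply: ge0_subset_integral => //.
- apply: emeasurable_funM; last exact: measurable_dens2.
  by apply/measurable_EFinP.
- by move=> x /=; rewrite in_itv /= => /andP[x0 _]; apply: mule_ge0.
- by move=> x /=; rewrite !in_itv /= => /andP[/ltW -> /ltW ->].
Qed.

Lemma nu_inner_large (M : R) : nu Lam `[0%R, 1%R] = +oo%E ->
  exists2 e : R, 0 < e <= 1 / 2%:R &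
    (M%:E <= \int[Lam]_(x in `[e, (1 / 2%:R)%R]) ((x ^- 2)%R)%:E)%E.
Proof.
move=> nuoo.
pose F (i : nat) : set R := `[i.+1%:R^-1, 1 / 2%:R]%classic.
have F0 i x : F i x -> 0 < x.
  by rewrite /F /= in_itv /= => /andP[+ _]; apply: lt_le_trans; rewrite invr_gt0.
have bigF : \bigcup_i F i = `]0, 1 / 2%:R]%classic.
  apply/seteqP; split => x.
    by move=> [i _ Fx]; move: (Fx); rewrite /F /= !in_itv /= (F0 _ _ Fx) => /andP[].
  rewrite /= in_itv /= => /andP[x0 x12].
  exists (Num.truncn x^-1) => //; rewrite /F /= in_itv /= x12 andbT.
  rewrite invf_ple ?posrE // ltW // truncnS_gt //.
have cv : (\int[Lam]_(x in F i) dens2 x)%E @[i --> \oo] --> (\int[Lam]_(x in \bigcup_i F i) dens2 x)%E.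
  apply: ge0_nondecreasing_set_cvg_integral => //.
  - apply/nondecreasing_seqP => i; apply/subsetPset => x; rewrite /F /= !in_itv /=.
    move=> /andP[h ->]; rewrite andbT; apply: le_trans h.
    by rewrite lef_pV2 ?posrE // ler_nat.
  - by move=> i; exact: measurable_itv.
  - move=> i; apply: measurable_funS measurable_dens2 => //.
    move=> x Fx; have := F0 _ _ Fx; move: Fx; rewrite /F /= !in_itv /= => /andP[_ x2] /ltW ->.
    by rewrite (le_trans x2) // ler_pdivrMr // mul1r ler1n.
have oo : (\int[Lam]_(x in `]0%R, (1 / 2%:R)%R]) dens2 x)%E = +oo%E.
  have e01 : `[0, 1]%classic = [set 0] `|` (`]0, 1 / 2%:R]%classic `|` `]1 / 2%:R, 1]%classic) :> set R.
    apply/seteqP; split => x /=; rewrite !in_itv /=.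
      move=> /andP[x0 ->]; rewrite andbT; have [->|xn0] := eqVneq x 0; first by left.
      by right; rewrite lt_neqAle x0 eq_sym xn0 /=; case: (leP x (1 / 2%:R)) => h; [left|right].
    move=> [->|[/andP[x0 x1]|/andP[x0 x1]]]; first by rewrite lexx ler01.
      by rewrite ltW //=; lra.
    by rewrite x1 andbT; lra.
  apply/eqP; apply: contraT => noo.
  have m01 (E : set R) : E `<=` `[0, 1]%classic -> measurable E -> measurable_fun E (@dens2 R).
    by move=> sE mE; apply: measurable_funS measurable_dens2.
  move: nuoo; rewrite /nu e01 ge0_integral_setU //; last 3 first.
  - exact: measurableU.
  - by rewrite -e01; exact: measurable_dens2.
  - apply/disj_setPS => x [/= -> []]; rewrite /= in_itv /= ?ltxx //.
    by move=> /andP[h _]; move: h; lra.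
  rewrite null_set_integral //; last exact: measurable_fun_set1.
  rewrite add0e ge0_integral_setU //; last 2 first.
  - by apply: m01; [rewrite e01; exact: subsetUr|exact: measurableU].
  - apply/disj_setPS => x [/=]; rewrite !in_itv /= => /andP[_ h1] /andP[h2 _].
    by move: (lt_le_trans h2 h1); rewrite ltxx.
  move=> nuoo; suff : (+oo < +oo :> \bar R)%E by rewrite ltxx.
  rewrite -[X in (X < _)%E]nuoo lte_add_pinfty //; first by rewrite ltey.
  apply: (@le_lt_trans _ _ (\int[Lam]_(x in `](1 / 2%:R)%R, 1%R]) (cst 4%:R%:E x))%E).
    apply: ge0_le_integral => //.
    - apply: m01 => //; rewrite e01 => x h; right; by right.
    - move=> x /=; rewrite in_itv /= => /andP[h _].
      have x0 : 0 < x by move: h; lra.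
      rewrite /dens2 gt_eqF // lee_fin -[leRHS]invrK lef_pV2 ?posrE ?exprn_gt0 ?invr_gt0 //.
      by rewrite expr2; nra.
  by rewrite integral_cst // lte_mul_pinfty // ltey_eq fin_num_measure.
rewrite bigF oo in cv.
have /cvgeyPge/(_ M) [i _ /(_ i (leqnn _)) /= h] := cv.
exists (Num.min i.+1%:R^-1 (1 / 2%:R)); first by rewrite lt_min ge_min lexx orbT andbT invr_gt0 ltr0n divr_gt0.
apply: le_trans h _.
rewrite (eq_integral (fun x : R => ((x ^- 2)%R)%:E)); last first.
  by move=> x; rewrite inE => /F0 x0; rewrite /dens2 gt_eqF.
apply: ge0_subset_integral => //.
- exact: measurable_itv.
- apply/measurable_EFinP.
  apply: measurable_invr_sqr_gt0; first exact: measurable_itv.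
  move=> x /=; rewrite !in_itv /= andbT => /andP[h _].
  by apply: lt_le_trans h; rewrite lt_min invr_gt0 ltr0n divr_gt0.
- by move=> x _; rewrite lee_fin invr_ge0 sqr_ge0.
- move=> x; rewrite /F /= !in_itv /= => /andP[h ->]; rewrite andbT.
  by rewrite ge_min h.
Qed.

Lemma Lam_near1 (e : R) : 0 < e ->
  exists2 h : R, 0 < h <= 1 / 2%:R & (Lam `](1 - h)%R, 1%R[ <= e%:E)%E.
Proof.
move=> e0.
pose F (i : nat) : set R := `](1 - i.+2%:R^-1), 1[%classic.
have F0 : \bigcap_i F i = set0.
  rewrite -subset0 => x Fx.
  have x1 : x < 1 by have := Fx 0%N I; rewrite /F /= in_itv /= => /andP[].
  have d0 : 0 < 1 - x by rewrite subr_gt0.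
  have := Fx (Num.truncn (1 - x)^-1) I; rewrite /F /= in_itv /= x1 andbT.
  rewrite ltrBlDr -ltrBlDl invf_pgt ?posrE //.
  move=> h; have := truncnS_gt (1 - x)^-1 => h2.
  have := lt_trans h h2.
  by rewrite ltr_nat ltnNge leqnSn.
have cv : Lam \o F @ \oo --> Lam (\bigcap_i F i).
  apply: nonincreasing_cvg_mu => //.
  - by rewrite ltey_eq fin_num_measure //; exact: measurable_itv.
  - by move=> i; exact: measurable_itv.
  - by rewrite F0.
  - apply/nonincreasing_seqP => i; apply/subsetPset => x; rewrite /F /= !in_itv /=.
    move=> /andP[h ->]; rewrite andbT; apply: le_lt_trans h.
    by rewrite lerD2l lerN2 lef_pV2 ?posrE // ler_nat.
rewrite F0 measure0 in cv.
have /fine_cvgP[_ /cvgrPdist_le/(_ e e0)] := cv.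
move=> -[i _ /(_ i (leqnn _))]; rewrite /= sub0r normrN => h.
exists i.+2%:R^-1.
  by rewrite invr_gt0 ltr0n /= div1r lef_pV2 ?posrE // ler_nat.
rewrite -[leLHS]fineK ?fin_num_measure //.
by rewrite lee_fin (le_trans (ler_norm _)).
Qed.

End Rates.

Section Harmonic.
Local Open Scope classical_set_scope.
Variable R : realType.

Definition harmonic_sum (k : nat) : R := \sum_(j < k) j.+1%:R^-1.

Lemma harmonic_sumS k : harmonic_sum k.+1 = harmonic_sum k + k.+1%:R^-1.
Proof. by rewrite /harmonic_sum big_ord_recr. Qed.

Lemma harmonic_sum_homo : {homo harmonic_sum : a b / (a <= b)%N >-> a <= b}.
Proof.
move=> a b /subnK <-; elim: (b - a)%N => [|k IH]; first by rewrite add0n.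
by rewrite addSn harmonic_sumS (le_trans IH) // lerDl invr_ge0.
Qed.

Lemma harmonic_sum_sub_le s a : (a <= s)%N ->
  harmonic_sum s - harmonic_sum (s - a) <= a%:R / (s - a).+1%:R.
Proof.
move=> as_; rewrite lerBlDl.
have key d : harmonic_sum (d + a) <= harmonic_sum d + a%:R / d.+1%:R.
  elim: a {as_} => [|a IH]; first by rewrite addn0 mul0r addr0.
  rewrite addnS harmonic_sumS -[a.+1%:R]natr1 mulrDl mul1r addrA lerD //.
  by rewrite lef_pV2 ?posrE // ler_nat ltnS leq_addr.
by have := key (s - a)%N; rewrite subnK.
Qed.

Lemma harmonic_sum_unbounded (M : R) : exists N, forall n, (N <= n)%N -> M <= harmonic_sum n.
Proof.
have sE : harmonic_sum = series (@harmonic R).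
  by apply/funext => k; rewrite /harmonic_sum /series /= big_mkord.
have nd : nondecreasing_seq harmonic_sum by move=> a b; exact: harmonic_sum_homo.
have nc : ~ cvgn harmonic_sum by rewrite sE; exact: dvg_harmonic.
have /cvgryPge/(_ M)[N _ h] := nondecreasing_dvgn_lt nd nc.
by exists N => n Nn; exact: h.
Qed.

End Harmonic.

Section SubsetRates.
Local Open Scope classical_set_scope.
Variables (R : realType) (Lam : {finite_measure set R -> \bar R}).
Hypotheses (Lam0 : Lam [set 0] = 0%E) (Lam1 : Lam [set 1] = 0%E).
Hypothesis moment_fin : (nu_first_moment Lam < +oo)%E.
Local Notation mu := (fine (nu_first_moment Lam)).

Lemma moment_ge0 : (0 <= nu_first_moment Lam)%E.
Proof.
apply: integral_ge0 => x /=; rewrite in_itv /= => /andP[x0 _].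
by apply: mule_ge0; [rewrite lee_fin|exact: dens2_ge0].
Qed.

Lemma momentK : mu%:E = nu_first_moment Lam.
Proof. by rewrite fineK // ge0_fin_numE // moment_ge0. Qed.

Lemma rate_densityE (T : finType) (A S : {set T}) (x : R) :
  0 < x -> (1 < #|S|)%N -> rate_density #|A| #|S| x = x ^- 2 * bern A x S.
Proof.
move=> x0 S1; rewrite /rate_density /bern mulrA; congr (_ * _).
by rewrite -{2}(subnK S1) addnC exprD mulKf // expf_neq0 // gt_eqF.
Qed.

Lemma measurable_invr01 :
  measurable_fun (`]0, 1[%classic : set R) (fun x : R => x^-1).
Proof.
apply: measurable_invr_gt0 => // x /=.
by rewrite !in_itv /= andbT => /andP[].
Qed.

Lemma rate_mem_le (T : finType) (A : {set T}) i : i \in A ->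
  \sum_(S : {set T} | (S \subset A) && (1 < #|S|)%N && (i \in S))
     lam_rate Lam #|A| #|S| <= mu.
Proof.
move=> iA; rewrite -lee_fin momentK; apply: le_trans (first_moment_int Lam).
under eq_bigr do rewrite -[lam_rate _ _ _]mulr1.
apply: lam_rate_sum_le => //; first exact: measurable_invr01.
move=> x /andP[x0 x1].
rewrite (eq_bigr (fun S => x ^- 2 * bern A x S)); last first.
  by move=> S /andP[/andP[_ S1] _]; rewrite mulr1 rate_densityE.
rewrite -big_distrr /= expr2 invfM -mulrA -[leRHS]mulr1.
rewrite ler_wpM2l ?invr_ge0 ?(ltW x0) // mulrC ler_pdivrMr // mul1r.
rewrite -[leRHS](sum_bern_mem iA x1) [leRHS]big_mkcond [leLHS]big_mkcond /=.
apply: ler_sum => S _; have b0 : 0 <= bern A x S by rewrite bern_ge0 // !ltW.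
by case: (S \subset A); case: (i \in S); case: (1 < #|S|)%N.
Qed.

Lemma rate_harmonic_le (T : finType) (A D : {set T}) (h e : R) : D \subset A ->
  0 < h <= 1 / 2%:R -> (Lam `](1 - h)%R, 1%R[ <= e%:E)%E ->
  \sum_(S : {set T} | (S \subset A) && (1 < #|S|)%N)
     lam_rate Lam #|A| #|S| * (harmonic_sum R #|D| - harmonic_sum R (#|D| - #|(S :&: D)%SET|)%N) <=
  mu / h + 4%:R * harmonic_sum R #|D| * e.
Proof.
move=> DA /andP[h0 h12] Le.
set H := harmonic_sum R #|D|.
have H0 : 0 <= H by apply: sumr_ge0 => j _; rewrite invr_ge0.
have dH S : 0 <= H - harmonic_sum R (#|D| - #|(S :&: D)%SET|)%N.
  by rewrite subr_ge0 harmonic_sum_homo // leq_subr.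
have dH2 S : H - harmonic_sum R (#|D| - #|(S :&: D)%SET|)%N <= H.
  by rewrite gerBl; apply: sumr_ge0 => j _; rewrite invr_ge0.
have mI : measurable (`]1 - h, 1[%classic : set R) by exact: measurable_itv.
pose phi (x : R) := h^-1 * x^-1 + 4%:R * H * \1_(`]1 - h, 1[%classic) x.
rewrite -lee_fin.
apply: (@le_trans _ _ (\int[Lam]_(x in `]0%R, 1%R[) (phi x)%:E)%E).
  apply: lam_rate_sum_le => //.
    apply: measurable_funD; apply: measurable_funM => //.
    exact: measurable_invr01.
  move=> x /andP[x0 x1].
  rewrite (eq_bigr (fun S => x ^- 2 * (bern A x S * (H - harmonic_sum R (#|D| - #|(S :&: D)%SET|)%N)))); last first.
    by move=> S /andP[_ S1]; rewrite rate_densityE // -mulrA.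
  rewrite -big_distrr /=.
  have b0 S : 0 <= bern A x S by rewrite bern_ge0 // !ltW.
  have le1 : \sum_(S : {set T} | (S \subset A) && (1 < #|S|)%N)
      bern A x S * (H - harmonic_sum R (#|D| - #|(S :&: D)%SET|)%N) <= x / (1 - x).
    apply: le_trans (sum_bern_ratio DA _); last by rewrite x1 ltW.
    rewrite [leLHS]big_mkcondr /=; apply: ler_sum => S _.
    case: ifP => _; last by rewrite mulr_ge0 // divr_ge0.
    rewrite ler_wpM2l // harmonic_sum_sub_le // subset_leq_card //.
    by apply/fintype.subsetP => y; rewrite inE => /andP[].
  have le2 : \sum_(S : {set T} | (S \subset A) && (1 < #|S|)%N)
      bern A x S * (H - harmonic_sum R (#|D| - #|(S :&: D)%SET|)%N) <= H.
    rewrite -[leRHS]mul1r -(sum_bern A x) big_distrl /= [leLHS]big_mkcondr /=.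
    apply: ler_sum => S _; case: ifP => _; last by rewrite mulr_ge0.
    by rewrite ler_wpM2l.
  have x2 : 0 <= x ^- 2 by rewrite invr_ge0 sqr_ge0.
  rewrite /phi indicE; case: (leP x (1 - h)) => xh.
    rewrite memNset ?mulr0 ?addr0; last by rewrite /= in_itv /= ltNge xh.
    apply: (le_trans (ler_wpM2l x2 le1)).
    rewrite expr2 invfM -!mulrA [x^-1 * (x * _)]mulrA mulVf ?gt_eqF // mul1r mulrC.
    rewrite ler_wpM2r ?invr_ge0 ?(ltW x0) // lef_pV2 ?posrE //; lra.
  rewrite mem_set ?mulr1; last by rewrite /= in_itv /= xh.
  apply: (le_trans (ler_wpM2l x2 le2)).
  apply: (@le_trans _ _ (4%:R * H)); last by rewrite lerDr mulr_ge0 // invr_ge0 ltW.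
  rewrite ler_wpM2r // -[leRHS]invrK lef_pV2 ?posrE ?exprn_gt0 ?invr_gt0 //.
  by rewrite expr2; nra.
under eq_integral do rewrite /phi EFinD EFinM [in X in (_ + X)%E]EFinM.
have hV0 : 0 <= h^-1 by rewrite invr_ge0 ltW.
have H40 : 0 <= 4%:R * H by rewrite mulr_ge0.
rewrite ge0_integralD //; last 4 first.
- move=> x /itv_oo01/andP[x0 _]; rewrite -EFinM lee_fin mulr_ge0 // invr_ge0 ltW //.
- by apply/measurable_EFinP; apply: measurable_funM => //; exact: measurable_invr01.
- by move=> x _; rewrite -EFinM lee_fin mulr_ge0 // indicE.
- by apply/measurable_EFinP; apply: measurable_funM.
rewrite !ge0_integralZl_EFin //; last 3 first.
- by apply/measurable_EFinP.
- by move=> x /itv_oo01/andP[x0 _]; rewrite lee_fin invr_ge0 ltW.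
- by apply/measurable_EFinP; exact: measurable_invr01.
rewrite integral_indic // EFinD; apply: leeD.
  rewrite mulrC EFinM; apply: lee_wpmul2l; first by rewrite lee_fin.
  by rewrite momentK; exact: first_moment_int.
rewrite [in leRHS]EFinM; apply: lee_wpmul2l; first by rewrite lee_fin.
apply: le_trans Le; apply: le_measure; rewrite ?inE //; exact: measurableI.
Qed.

Lemma binomial_tail_decr (x : R) s : 0 <= x <= 1 ->
  (1 - x) ^+ s.+1 + s.+1%:R * x * (1 - x) ^+ s <=
  (1 - x) ^+ s + s%:R * x * (1 - x) ^+ s.-1.
Proof.
move=> /andP[x0 x1]; case: s => [|s].
  by rewrite expr1 expr0 mul0r mul0r addr0 mulr1 mul1r subrK.
rewrite /= -[s.+2%:R]natr1 !exprS; set q := (1 - x) ^+ s; set a : R := s.+1%:R.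
have q0 : 0 <= q by rewrite exprn_ge0 // subr_ge0.
have a0 : 0 <= a by [].
rewrite -subr_ge0 [leRHS](_ : _ = a * x * x * q); last by ring.
by rewrite !mulr_ge0.
Qed.

Lemma rate_inside_ge (M : R) (m : nat) : nu Lam `[0%R, 1%R] = +oo%E ->
  exists s0, forall (T : finType) (A D : {set T}), D \subset A ->
    (s0 <= #|D|)%N -> (#|A| <= #|D| + m)%N ->
    M <= \sum_(S : {set T} | (S \subset D) && (1 < #|S|)%N) lam_rate Lam #|A| #|S|.
Proof.
move=> nuoo.
pose k : R := 2%:R^-1 ^+ m.+1.
have k0 : 0 < k by rewrite exprn_gt0 // invr_gt0.
have [d /andP[d0 d12] hd] := nu_inner_large Lam0 (M / k) nuoo.
pose r0 := (Num.truncn (8%:R / d)).+1.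
exists (2 * r0)%N => T A D DA sD bD.
have mV : measurable_fun (`[d, 1 / 2%:R]%classic : set R) (fun x : R => x ^- 2).
  apply: measurable_invr_sqr_gt0 => // x /=.
  by rewrite !in_itv /= andbT => /andP[+ _]; exact: lt_le_trans.
under eq_bigr do rewrite -[lam_rate _ _ _]mulr1.
rewrite -lee_fin.
apply: (@le_trans _ _ (\int[Lam]_(x in `[d, (1 / 2%:R)%R]) (k * x ^- 2)%:E)%E).
  under eq_integral do rewrite EFinM.
  rewrite ge0_integralZl_EFin //; last 3 first.
  - by move=> x _; rewrite lee_fin invr_ge0 sqr_ge0.
  - exact/measurable_EFinP.
  - exact: ltW.
  apply: le_trans (lee_wpmul2l _ hd); last by rewrite lee_fin ltW.
  by rewrite -EFinM mulrC divfK ?gt_eqF.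
apply: lam_rate_sum_ge => //.
- by move=> x /=; rewrite !in_itv /= => /andP[h1 h2]; rewrite (lt_le_trans d0) //=; lra.
- exact: measurable_funM.
- by move=> x _; rewrite mulr_ge0 ?(ltW k0) // invr_ge0 sqr_ge0.
move=> x /=; rewrite in_itv /= => /andP[dx x12].
have x0 : 0 < x by exact: lt_le_trans dx.
have q0 : 0 <= 1 - x by lra.
have q2 : 2%:R^-1 <= 1 - x by lra.
rewrite (eq_bigr (fun S => x ^- 2 * ((1 - x) ^+ (#|A| - #|D|) * bern D x S))); last first.
  move=> S /andP[SD S1]; rewrite mulr1 rate_densityE //; congr (_ * _).
  rewrite /bern mulrCA -exprD addnBA ?subset_leq_card //.
  by rewrite subnK // subset_leq_card.
rewrite -big_distrr -big_distrr /= mulrC ler_wpM2l ?invr_ge0 ?sqr_ge0 //.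
rewrite sum_bern_gt1 /k exprSr.
rewrite ler_pM ?exprn_ge0 ?invr_ge0 //.
  apply: (@le_trans _ _ ((1 - x) ^+ m)); first by rewrite lerXn2r ?nnegrE ?invr_ge0.
  rewrite ler_wiXn2l //; first by lra.
  by rewrite leq_subLR.
have tail : (1 - x) ^+ #|D| + #|D|%:R * x * (1 - x) ^+ #|D|.-1 <= 2%:R^-1; last first.
  by move: tail; lra.
have x01 : 0 <= x <= 1 by rewrite ltW //=; lra.
have dec a b : (a <= b)%N -> (1 - x) ^+ b + b%:R * x * (1 - x) ^+ b.-1 <=
   (1 - x) ^+ a + a%:R * x * (1 - x) ^+ a.-1.
  move=> /subnK <-; elim: (b - a)%N => [|j IH]; first by rewrite add0n.
  by rewrite addSn; apply: le_trans IH; exact: binomial_tail_decr.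
apply: (le_trans (dec _ _ sD)); apply: (le_trans (binomial_tail_bound _ _)).
  by rewrite x0.
have rx : 8%:R <= r0%:R * x.
  apply: (@le_trans _ _ (r0%:R * d)); last by rewrite ler_wpM2l.
  by rewrite -ler_pdivrMr // ltW // truncnS_gt.
rewrite ler_pdivrMr; lra.
Qed.

End SubsetRates.

(** * Lyapunov functions *)

Section Lyapunov.
Import mathcomp.boot.fintype mathcomp.boot.finset.
Variables (R : realType) (Lam : {finite_measure set R -> \bar R}).
Hypotheses (Lam0 : Lam (classical_sets.set1 0) = 0%E) (Lam1 : Lam (classical_sets.set1 1) = 0%E).
Hypothesis moment_fin : (nu_first_moment Lam < +oo)%E.
Local Notation mu := (fine (nu_first_moment Lam)).

Lemma lam_rate_ge0 i k : 0 <= lam_rate Lam i k.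
Proof.
apply: fine_ge0; apply: integral_ge0 => x /=; rewrite in_itv /= => x01.
by rewrite lee_fin -/(rate_density i k x) rate_density_ge0.
Qed.

Lemma fine_moment_ge0 : 0 <= mu.
Proof. exact/fine_ge0/moment_ge0. Qed.

Definition block_deficit n (m : nat) (pi : fstate n) : R := (m.+1 - #|large_blocks pi|)%N%:R.

Lemma block_deficit_merge n m (pi S : fstate n) : partition pi [set: 'I_n] ->
  mergeable pi S ->
  block_deficit m (merge_blocks pi S) - block_deficit m pi <=
    m%:R / #|large_blocks pi|%:R * #|S :&: large_blocks pi|%:R
     - ((#|large_blocks pi| <= m)%N && (S \subset singleton_blocks pi))%:R.
Proof.
move=> Ppi mS; rewrite /block_deficit card_large_merge // subSS.
have BK : (#|S :&: large_blocks pi| <= #|large_blocks pi|)%N by rewrite subset_leq_card // subsetIr.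
have SB : (S \subset singleton_blocks pi) = (#|S :&: large_blocks pi| == 0%N).
  rewrite cards_eq0; apply/idP/eqP => [Ss|S0].
    apply/setP => B; rewrite !inE; apply/negP => /and3P[/(subsetP Ss)].
    by rewrite inE => /andP[_ /eqP ->].
  move: mS => /andP[Spi _]; apply/subsetP => B BS.
  have Bpi := subsetP Spi _ BS.
  have : B \notin S :&: large_blocks pi by rewrite S0 inE.
  rewrite !inE BS Bpi /=; have := partition_card_gt0 Ppi Bpi.
  by case: #|B| => [//|[|k]].
rewrite SB; move: #|S :&: large_blocks pi| #|large_blocks pi| BK => B K BK.
have [B0|B0] := posnP B.
  rewrite B0 subn0 mulr0 sub0r andbT.
  case: leqP => Km; first by rewrite subSn // -natr1 opprD addNKr.
  by rewrite (eqP (ltnW Km : (m - K == 0)%N)) (eqP (Km : (m.+1 - K == 0)%N)) subrr oppr0.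
have K0 : (0 < K)%N by exact: leq_trans BK.
have K0R : 0 < K%:R :> R by rewrite ltr0n.
rewrite andbF subr0 mulrAC ler_pdivlMr //.
have [Km|Km] := leqP K m.
  rewrite -natrB; last by lia.
  by rewrite -!natrM ler_nat; nia.
have -> : (m.+1 - K = 0)%N by lia.
rewrite subr0 -!natrM ler_nat.
have [h|h] := leqP m (K - B); first by rewrite (eqP (h : (m - (K - B) == 0)%N)).
nia.
Qed.

Lemma drift_block_deficit n m (pi : fstate n) : partition pi [set: 'I_n] ->
  Qfun Lam (block_deficit m) pi <= m%:R * mu -
    (#|large_blocks pi| <= m)%N%:R * \sum_(S : fstate n | (S \subset singleton_blocks pi) && (1 < #|S|)%N)
      lam_rate Lam #|pi| #|S|.
Proof.
move=> Ppi; rewrite QfunE //.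
apply: (@le_trans _ _ (\sum_(S | mergeable pi S) (lam_rate Lam #|pi| #|S| *
   (m%:R / #|large_blocks pi|%:R * #|S :&: large_blocks pi|%:R) - lam_rate Lam #|pi| #|S| *
     ((#|large_blocks pi| <= m)%N && (S \subset singleton_blocks pi))%:R))).
  apply: ler_sum => S mS; rewrite -mulrBr ler_wpM2l ?lam_rate_ge0 //.
  exact: block_deficit_merge.
rewrite sumrB lerB //.
- rewrite (_ : \sum_(S | _) _ = m%:R / #|large_blocks pi|%:R * \sum_(C in large_blocks pi)
     \sum_(S : fstate n | (S \subset pi) && (1 < #|S|)%N && (C \in S)) lam_rate Lam #|pi| #|S|); last first.
    under [in RHS]eq_bigr do rewrite big_mkcondr /=.
    rewrite exchange_big /= big_distrr /=; apply: eq_bigr => S _.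
    rewrite mulrCA; congr (_ * _).
    rewrite -[#|S :&: _|]sum1_card natr_sum big_distrr /= big_mkcond [RHS]big_mkcond /=.
    by apply: eq_bigr => C _; rewrite inE mulr1; case: (C \in S); case: (C \in large_blocks pi).
  apply: (@le_trans _ _ (m%:R / #|large_blocks pi|%:R * \sum_(C in large_blocks pi) mu)).
    rewrite ler_wpM2l ?divr_ge0 //; apply: ler_sum => C; rewrite inE => /andP[Cpi _].
    exact: rate_mem_le.
  rewrite sumr_const -[mu *+ _]mulr_natl mulrA ler_wpM2r ?fine_moment_ge0 //.
  have [->|n0] := eqVneq #|large_blocks pi| 0%N; first by rewrite mulr0.
  by rewrite divfK // pnatr_eq0.
- rewrite mulr_sumr [leRHS]big_mkcond [leLHS]big_mkcond /=; apply: ler_sum => S _.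
  have l0 := lam_rate_ge0 #|pi| #|S|.
  rewrite /mergeable; have [Ss|_] /= := boolP (S \subset singleton_blocks pi); last first.
    by case: ifP => _ //; rewrite andbF mulr0.
  have -> : S \subset pi.
    by apply: subset_trans Ss _; apply/subsetP => B; rewrite inE => /andP[].
  by case: ifP => //= _; rewrite andbT mulrC.
Qed.

Lemma drift_harmonic n (pi : fstate n) (h e : R) : partition pi [set: 'I_n] ->
  0 < h <= 1 / 2%:R -> (Lam `](1 - h)%R, 1%R[%classic <= e%:E)%E -> 0 <= e ->
  (#|singleton_blocks pi| <= n)%N ->
  Qfun Lam (fun s => - harmonic_sum R #|singleton_blocks s|) pi <= mu / h + 4%:R * harmonic_sum R n * e.
Proof.
move=> Ppi h0 Le e0 sn; rewrite QfunE //.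
have sub : singleton_blocks pi \subset pi by apply/subsetP => B; rewrite inE => /andP[].
apply: (le_trans _ (_ : mu / h + 4%:R * harmonic_sum R #|singleton_blocks pi| * e <= _)); last first.
  by rewrite lerD2l ler_wpM2r // ler_wpM2l // harmonic_sum_homo.
apply: le_trans (rate_harmonic_le Lam0 Lam1 moment_fin sub h0 Le).
rewrite le_eqVlt; apply/orP; left; apply/eqP; apply: eq_bigr => S mS.
by rewrite card_singleton_merge // opprK addrC.
Qed.

Lemma card_singleton_le n (pi : fstate n) : partition pi [set: 'I_n] ->
  (#|singleton_blocks pi| <= n)%N.
Proof.
move=> Ppi; have := card_partition Ppi; rewrite cardsT card_ord => nE.
have sub : singleton_blocks pi \subset pi by apply/subsetP => B; rewrite inE => /andP[].
apply: (leq_trans (subset_leq_card sub)); rewrite [leqRHS]nE -sum1_card.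
by apply: leq_sum => B; exact: partition_card_gt0.
Qed.

Lemma card_singleton_singletons n : #|singleton_blocks (singletons_n n)| = n.
Proof.
have -> : singleton_blocks (singletons_n n) = singletons_n n.
  apply/setP => B; rewrite inE andbC; case: (boolP (B \in _)); last by rewrite andbF.
  by move=> /imsetP[i _ ->]; rewrite cards1.
by rewrite card_imset ?cardT ?size_enum_ord // => i j /set1_inj.
Qed.

Hypothesis row : forall n u, 0 <= u ->
  [/\ forall pi, 0 <= ptrans Lam u (singletons_n n) pi,
      \sum_pi ptrans Lam u (singletons_n n) pi = 1 &
      forall pi, ~~ partition pi [set: 'I_n] -> ptrans Lam u (singletons_n n) pi = 0].

Local Notation Ex n := (chain_mean Lam (singletons_n n)).

Lemma Ex_le n (f g : fstate n -> R) u : 0 <= u ->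
  (forall pi, partition pi [set: 'I_n] -> f pi <= g pi) -> Ex n f u <= Ex n g u.
Proof.
move=> u0 fg; have [p0 _ pP] := row n u0; rewrite !chain_meanE; apply: ler_sum => pi _.
have [/fg h|/pP ->] := boolP (partition pi [set: 'I_n]); last by rewrite !mul0r.
by rewrite ler_wpM2l.
Qed.

Lemma Ex_cst n (c : R) u : 0 <= u -> Ex n (fun=> c) u = c.
Proof. by move=> u0; rewrite chain_meanE -big_distrl /=; have [_ -> _] := row n u0; rewrite mul1r. Qed.

Lemma ExD n (f g : fstate n -> R) u :
  Ex n (fun s => f s + g s) u = Ex n f u + Ex n g u.
Proof. by rewrite !chain_meanE -big_split /=; apply: eq_bigr => s _; rewrite mulrDr. Qed.

Lemma ExZ n c (f : fstate n -> R) u : Ex n (fun s => c * f s) u = c * Ex n f u.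
Proof. by rewrite !chain_meanE big_distrr /=; apply: eq_bigr => s _; rewrite mulrCA. Qed.

Lemma few_singletons_unlikely (s0 : nat) (t e : R) : 0 < t -> 0 < e ->
  exists N, forall n u, (N <= n)%N -> 0 <= u <= t ->
    Ex n (fun s => (#|singleton_blocks s| < s0)%N%:R) u <= e.
Proof.
move=> t0 e0.
pose e1 := e / (16%:R * t).
have e10 : 0 < e1 by rewrite divr_gt0 // mulr_gt0.
have [h h0 Le] := Lam_near1 Lam e10.
have hp : 0 < h by case/andP: h0.
have [hge tge ege] : [/\ 0 <= h, 0 <= t & 0 <= e] by split; exact: ltW.
have mge := fine_moment_ge0.
have [c cE] : exists c, c = 4%:R * t * (mu / h) / e by eexists.
have [N HN] := harmonic_sum_unbounded (2%:R * harmonic_sum R s0 + 1 + c).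
exists N => n u Nn /andP[u0 ut].
set Hn := harmonic_sum R n.
have Hs0 : 0 <= harmonic_sum R s0 by apply: sumr_ge0 => j _; rewrite invr_ge0.
have c_ge0 : 0 <= c.
  by rewrite cE divr_ge0 // mulr_ge0 // ?divr_ge0 // mulr_ge0.
have HnN := HN n Nn; rewrite -/Hn in HnN.
have Hn1 : 1 <= Hn by lra.
have Hns : Hn / 2%:R <= Hn - harmonic_sum R s0 by lra.
have dr : Ex n (fun s => - harmonic_sum R #|singleton_blocks s|) u <= - Hn + (mu / h + 4%:R * Hn * e1) * u.
  have := @derive_le_linear _ _ _ (mu / h + 4%:R * Hn * e1) u u0
     (is_derive_chain_mean Lam (singletons_n n) (fun s => - harmonic_sum R #|singleton_blocks s|)).
  rewrite chain_mean0 card_singleton_singletons; apply => v /andP[v0 vu].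
  rewrite -[leRHS](@Ex_cst n _ v v0); apply: Ex_le => // pi Ppi.
  by apply: drift_harmonic => //; [exact: ltW|exact: card_singleton_le].
have c0 : 0 < 2%:R / Hn by rewrite divr_gt0 //; lra.
apply: (@le_trans _ _ (Ex n (fun s => 2%:R / Hn * (Hn + - harmonic_sum R #|singleton_blocks s|)) u)).
  apply: Ex_le => // pi Ppi; have sn := harmonic_sum_homo R (card_singleton_le Ppi).
  have [lt|_] := ltnP; last by rewrite mulr_ge0 ?(ltW c0) // subr_ge0.
  have := harmonic_sum_homo R (ltnW lt) => h1.
  apply: (@le_trans _ _ (2%:R / Hn * (Hn / 2%:R))).
    by rewrite [leRHS](_ : _ = 1) //; field; rewrite gt_eqF //; lra.
  by rewrite ler_wpM2l ?(ltW c0) //; move: Hns; rewrite /Hn; lra.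
rewrite ExZ ExD Ex_cst // -ler_pdivlMl // invf_div.
apply: (le_trans (lerD (lexx Hn) dr)); rewrite addrA subrr add0r.
have a0 : 0 <= mu / h + 4%:R * Hn * e1.
  apply: addr_ge0; first exact: divr_ge0.
  by apply: mulr_ge0; [lra|exact: ltW].
apply: (le_trans (ler_wpM2l a0 ut)); rewrite mulrDl.
have -> : 4%:R * Hn * e1 * t = Hn * e / 4%:R by rewrite /e1; field; rewrite gt_eqF.
have : 4%:R * t * (mu / h) <= Hn * e by rewrite -ler_pdivrMr // -cE; move: HnN Hs0; rewrite -/Hn; lra.
by lra.
Qed.

Lemma few_blocks_unlikely (m : nat) (t e : R) :
  nu Lam `[0%R, 1%R]%classic = +oo%E -> 0 < t -> 0 < e ->
  exists N, forall n, (N <= n)%N -> Ex n (fun s => (#|large_blocks s| <= m)%N%:R) t <= e.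
Proof.
move=> nuoo t0 e0.
pose m1 : R := m.+1%:R.
have m10 : 0 < m1 by rewrite ltr0n.
pose G := 2%:R * (m1 * m1 / t + m1 * (m%:R * mu)) / e + 1.
have c0 : 0 <= m1 * m1 / t + m1 * (m%:R * mu).
  by rewrite addr_ge0 ?divr_ge0 ?mulr_ge0 ?fine_moment_ge0 // ltW.
have G0 : 0 < G by rewrite ltr_wpDl // divr_ge0 ?mulr_ge0 // ltW.
have [s0 hs0] := rate_inside_ge Lam0 Lam1 G m nuoo.
have e20 : 0 < e / (2%:R * m1) by rewrite divr_gt0 // mulr_gt0.
have [N HN] := few_singletons_unlikely s0 t0 e20.
exists N => n Nn.
apply: (@le_trans _ _ (Ex n (block_deficit m) t)).
  apply: Ex_le => [|pi _]; first exact: ltW.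
  by rewrite ler_nat; case: leqP => h; lia.
pose L := G / m1.
have L0 : 0 < L by rewrite divr_gt0.
pose a := m%:R * mu + G * (e / (2%:R * m1)).
have a0 : 0 <= a.
  apply: addr_ge0; apply: mulr_ge0 => //; first exact: fine_moment_ge0.
  - exact: ltW.
  - exact: ltW.
have pd pi : partition pi [set: 'I_n] -> Qfun Lam (block_deficit m) pi <=
    m%:R * mu + (G * (#|singleton_blocks pi| < s0)%N%:R + - L * block_deficit m pi).
  move=> Ppi; apply: (le_trans (drift_block_deficit m Ppi)); rewrite lerD2l.
  have r0 : 0 <= \sum_(S : fstate n | (S \subset singleton_blocks pi) && (1 < #|S|)%N) lam_rate Lam #|pi| #|S|.
    by apply: sumr_ge0 => S _; exact: lam_rate_ge0.
  have [Km|Km] := leqP #|large_blocks pi| m; last first.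
    by rewrite mul0r oppr0 /block_deficit (eqP (Km : (m.+1 - #|large_blocks pi| == 0)%N)) mulr0 addr0 mulr_ge0 // ltW.
  rewrite mul1r.
  have fm : L * block_deficit m pi <= G.
    by rewrite /L mulrAC ler_pdivrMr // ler_wpM2l ?(ltW G0) // ler_nat leq_subr.
  have [lt|ge] := ltnP; first by rewrite mulr1; move: r0 fm; lra.
  have sub : singleton_blocks pi \subset pi by apply/subsetP => B; rewrite inE => /andP[].
  have : G <= \sum_(S : fstate n | (S \subset singleton_blocks pi) && (1 < #|S|)%N) lam_rate Lam #|pi| #|S|.
    by apply: hs0 => //; rewrite -(card_singleton_large Ppi) leq_add2l.
  by rewrite mulr0; move: fm; lra.
have f0 : 0 <= block_deficit m (singletons_n n) by [].
have := @derive_le_relax _ _ _ a L t t0 L0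
   (is_derive_chain_mean Lam (singletons_n n) (block_deficit m)).
rewrite chain_mean0 => /(_ _ f0 a0)/wrap[].
  move=> v /andP[v0 vt].
  apply: (le_trans (Ex_le v0 pd)); rewrite ExD Ex_cst // ExD !ExZ /a.
  have := HN n v Nn; rewrite v0 vt => /(_ isT) h.
  rewrite -addrA lerD2l mulNr lerD2r ler_wpM2l // ltW //.
move=> h; apply: (le_trans h).
have fle : block_deficit m (singletons_n n) <= m1 by rewrite ler_nat leq_subr.
have Lt0 : 0 < L * t by rewrite mulr_gt0.
apply: (@le_trans _ _ (m1 / (L * t) + a / L)).
  by rewrite lerD2r ler_wpM2r // invr_ge0 ltW.
have -> : m1 / (L * t) + a / L = (m1 * m1 / t + m1 * (m%:R * mu)) / G + e / 2%:R.
  by rewrite /a /L; field; rewrite !gt_eqF.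
suff : (m1 * m1 / t + m1 * (m%:R * mu)) / G <= e / 2%:R by lra.
rewrite ler_pdivrMr // /G mulrDr mulr1.
set c := m1 * m1 / t + m1 * (m%:R * mu).
have -> : e / 2%:R * (2%:R * c / e) = c by field; rewrite gt_eqF.
by rewrite lerDl divr_ge0 // ltW.
Qed.

End Lyapunov.

(** * Relabelling *)

Section Relabel.
Import mathcomp.boot.fintype mathcomp.boot.finset.
Variable n : nat.
Implicit Types (pi S : fstate n) (s : {perm 'I_n}).

Definition relabel s pi : fstate n := [set s @: (B : {set 'I_n}) | B in pi].

Lemma relabelK s : cancel (relabel s) (relabel s^-1).
Proof.
have sK (B : {set 'I_n}) : s^-1%g @: (s @: B) = B.
  by rewrite -imset_comp (eq_imset _ (permK s)) imset_id.
by move=> pi; rewrite /relabel -imset_comp (eq_imset _ sK) imset_id.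
Qed.

Lemma relabel_inj s : injective (relabel s).
Proof. exact: can_inj (relabelK s). Qed.

Let imset_perm_inj s : injective (fun B : {set 'I_n} => s @: B).
Proof. exact: imset_inj perm_inj. Qed.

Lemma card_relabel s pi : #|relabel s pi| = #|pi|.
Proof. exact: card_imset (@imset_perm_inj s). Qed.

Lemma relabelD s pi S : relabel s (pi :\: S) = relabel s pi :\: relabel s S.
Proof.
apply/setP => B; rewrite inE; apply/imsetP/andP => [[C]|[nS /imsetP[C Cp e]]].
  rewrite inE => /andP[CS Cp] ->; split; last exact: imset_f.
  by rewrite (mem_imset _ _ (@imset_perm_inj s)).
exists C => //; rewrite inE Cp andbT.
by apply: contra nS => CS; rewrite e imset_f.
Qed.

Lemma relabelU1 s pi B : relabel s (pi :|: [set B]) = relabel s pi :|: [set s @: B].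
Proof. by rewrite /relabel imsetU imset_set1. Qed.

Lemma cover_relabel s S : cover (relabel s S) = s @: cover S.
Proof.
rewrite /cover /relabel big_imset /=; last exact: in2W (@imset_perm_inj s).
apply/esym; apply: (big_morph (fun B : {set 'I_n} => s @: B)); last exact: imset0.
by move=> B C; exact: imsetU.
Qed.

Lemma partition_relabel s pi :
  partition pi [set: 'I_n] -> partition (relabel s pi) [set: 'I_n].
Proof.
move=> /and3P[/eqP cT /trivIsetP tr n0]; apply/and3P; split.
- rewrite cover_relabel cT; apply/eqP/setP => i; rewrite inE.
  by apply/imsetP; exists (s^-1%g i); rewrite ?inE ?permKV.
- apply/trivIsetP => B C /imsetP[B' B'p ->] /imsetP[C' C'p ->] BC.
  rewrite -setI_eq0 -imsetI; last by move=> ? ? _ _; exact: perm_inj.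
  rewrite imset_eq0 setI_eq0.
  by apply: tr => //; apply: contraNneq BC => ->.
- apply: contra n0 => /imsetP[B Bp /esym/eqP]; rewrite imset_eq0 => /eqP <- //.
Qed.

Lemma partition_relabelE s pi :
  partition (relabel s pi) [set: 'I_n] = partition pi [set: 'I_n].
Proof.
apply/idP/idP; last exact: partition_relabel.
by move=> /(partition_relabel s^-1); rewrite relabelK.
Qed.

Lemma is_merge_relabel s pi pi' :
  is_merge pi pi' -> is_merge (relabel s pi) (relabel s pi').
Proof.
move=> /existsP[S /and3P[Sp S1 /eqP ->]]; apply/existsP; exists (relabel s S).
rewrite imsetS //= card_relabel S1 /=.
by rewrite relabelU1 relabelD cover_relabel.
Qed.

Lemma is_merge_relabelE s pi pi' :
  is_merge (relabel s pi) (relabel s pi') = is_merge pi pi'.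
Proof.
apply/idP/idP; last exact: is_merge_relabel.
by move=> /(is_merge_relabel s^-1); rewrite !relabelK.
Qed.

Lemma relabel_singletons s : relabel s (singletons_n n) = singletons_n n.
Proof.
rewrite /relabel /singletons_n -imset_comp; apply/setP => B.
apply/imsetP/imsetP => -[i _ ->].
  by exists (s i) => //=; rewrite imset_set1.
by exists (s^-1%g i) => //=; rewrite imset_set1 permKV.
Qed.

Variables (R : realType) (Lam : {finite_measure set R -> \bar R}).

Lemma Qrate_relabel s pi pi' :
  Qrate Lam (relabel s pi) (relabel s pi') = Qrate Lam pi pi'.
Proof.
by rewrite /Qrate partition_relabelE is_merge_relabelE -relabelD !card_relabel.
Qed.

Lemma relabel_bij s : bijective (relabel s).
Proof.
exists (relabel s^-1); first exact: relabelK.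
by move=> pi; rewrite -{1}(invgK s) relabelK.
Qed.

Lemma Qgen_relabel s pi pi' :
  Qgen Lam (relabel s pi) (relabel s pi') = Qgen Lam pi pi'.
Proof.
rewrite /Qgen (inj_eq (@relabel_inj s)); case: eqP => _; last exact: Qrate_relabel.
rewrite (reindex (relabel s)) /=; last exact/onW_bij/relabel_bij.
congr (- _); apply: eq_big => [r|r _]; first by rewrite (inj_eq (@relabel_inj s)).
exact: Qrate_relabel.
Qed.

Lemma Qpow_relabel s k pi pi' :
  Qpow Lam k (relabel s pi) (relabel s pi') = Qpow Lam k pi pi'.
Proof.
elim: k pi' => [|k IH] pi' /=; first by rewrite (inj_eq (@relabel_inj s)).
rewrite (reindex (relabel s)) /=; last exact/onW_bij/relabel_bij.
by apply: eq_bigr => r _; rewrite IH Qgen_relabel.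
Qed.

Lemma ptrans_relabel s t pi :
  ptrans Lam t (singletons_n n) (relabel s pi) = ptrans Lam t (singletons_n n) pi.
Proof.
rewrite -{1}(relabel_singletons s) /ptrans.
by under eq_fun do under eq_bigr do rewrite Qpow_relabel.
Qed.

Definition linked pi (i j : 'I_n) : bool := [exists B in pi, (i \in B) && (j \in B)].

Lemma linked_relabel s pi i j : linked (relabel s pi) (s i) (s j) = linked pi i j.
Proof.
apply/exists_inP/exists_inP => -[B].
  move=> /imsetP[C Cp ->]; rewrite !mem_imset; try exact: perm_inj.
  by exists C.
move=> Bp ij; exists (s @: B); first exact: imset_f.
by rewrite !mem_imset //; exact: perm_inj.
Qed.

Lemma linked_restr (Rel : nat -> nat -> bool) (i j : 'I_n) :
  equivalence_rel Rel -> linked (restr n Rel) i j = Rel i j.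
Proof.
move=> eqR; have refl x : Rel x x by have [] := eqR x x x.
have tr x y z : Rel x y -> Rel x z = Rel y z by have [_] := eqR x y z.
have sym x y : Rel x y -> Rel y x by move=> xy; rewrite -(tr _ _ x xy) refl.
apply/exists_inP/idP.
  move=> [B /imsetP[k _ ->]]; rewrite !inE => /andP[ki kj].
  by rewrite -(tr _ _ _ ki).
move=> ij; exists [set k : 'I_n | Rel i k]; first exact: imset_f.
by rewrite !inE refl.
Qed.

Lemma partition_restr (Rel : nat -> nat -> bool) :
  equivalence_rel Rel -> partition (restr n Rel) [set: 'I_n].
Proof.
move=> eqR; have refl x : Rel x x by have [] := eqR x x x.
have tr x y z : Rel x y -> Rel x z = Rel y z by have [_] := eqR x y z.
have sym x y : Rel x y -> Rel y x by move=> xy; rewrite -(tr _ _ x xy) refl.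
apply/and3P; split.
- apply/eqP/setP => i; rewrite inE; apply/bigcupP.
  by exists [set j : 'I_n | Rel i j]; [exact: imset_f|rewrite inE].
- apply/trivIsetP => B C /imsetP[i _ ->] /imsetP[j _ ->] ne.
  rewrite -setI_eq0; apply: contraNT ne => /set0Pn[k]; rewrite !inE => /andP[ik jk].
  apply/eqP/setP => l; rewrite !inE (tr _ _ _ ik) (tr _ _ _ jk) //.
- apply/imsetP => -[i _ /setP/(_ i)]; by rewrite !inE refl.
Qed.

End Relabel.

(** * Exchangeable events *)

Section FiniteLaw.
Local Open Scope classical_set_scope.
Variables (d : measure_display) (T : measurableType d) (R : realType).
Variable P : probability T R.
Variables (V : finType) (Z : T -> V).
Hypothesis mZ : forall v, measurable [set w | Z w = v].

Definition mass v : R := fine (P [set w | Z w = v]).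

Lemma massK v : (mass v)%:E = P [set w | Z w = v].
Proof. by rewrite fineK // fin_num_measure. Qed.

Lemma mass_ge0 v : 0 <= mass v.
Proof. exact: fine_ge0. Qed.

Lemma law_seq (s : seq V) : uniq s -> measurable [set w | Z w \in s] /\
  P [set w | Z w \in s] = (\sum_(v <- s) mass v)%:E.
Proof.
elim: s => [_|v s IH /= /andP[vs us]].
  have -> : [set w | Z w \in [::]] = set0 by apply/seteqP; split.
  by rewrite big_nil measure0.
have [ms Ps] := IH us.
have E : [set w | Z w \in v :: s] = [set w | Z w = v] `|` [set w | Z w \in s].
  apply/seteqP; split => w /=; rewrite inE.
    by move=> /orP[/eqP|]; [left|right].
  by move=> [->|->]; rewrite ?eqxx ?orbT.
rewrite E; split; first exact: measurableU.
rewrite measureU //; last first.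
  by apply/seteqP; split => // w /= [->]; rewrite (negbTE vs).
by rewrite big_cons EFinD massK; congr (_ + _)%E.
Qed.

Lemma measurable_law (Q : pred V) : measurable [set w | Q (Z w)].
Proof.
have [m _] := law_seq (enum_uniq Q).
by rewrite [X in measurable X](_ : _ = [set w | Z w \in enum Q]) //;
  apply/seteqP; split => w /=; rewrite mem_enum.
Qed.

Lemma law_pred (Q : pred V) : P [set w | Q (Z w)] = (\sum_(v | Q v) mass v)%:E.
Proof.
have [_ +] := law_seq (enum_uniq Q); rewrite big_enum_cond /= => e.
rewrite [X in P X](_ : _ = [set w | Z w \in enum Q]); last first.
  by apply/seteqP; split => w /=; rewrite mem_enum.
by rewrite e; congr (_%:E); apply: eq_bigl => v; rewrite andbT.
Qed.

Lemma sum_mass : \sum_v mass v = 1.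
Proof.
have := law_pred xpredT; rewrite [X in P X](_ : _ = setT); last by apply/seteqP.
by rewrite probability_setT => -[].
Qed.

End FiniteLaw.

Section ExchangeableSequence.
Local Open Scope classical_set_scope.
Variables (d : measure_display) (T : measurableType d) (R : realType).
Variable P : probability T R.
Variable X : nat -> T -> bool.
Hypothesis mX : forall k, measurable [set w | X k w].

Definition prefix_vec n (w : T) : {ffun 'I_n -> bool} := [ffun k : 'I_n => X k w].

Definition hits n (w : T) : nat := (\sum_(k < n) X k w)%N.

Lemma measurable_prefix_vec n v : measurable [set w | prefix_vec n w = v].
Proof.
rewrite [X in measurable X](_ : _ = \bigcap_(k in [set: 'I_n]) [set w | X k w = v k]).
  apply: fin_bigcap_measurable => // k _; case: (v k); first exact: mX.
  rewrite [X in measurable X](_ : _ = ~` [set w | X k w]); first exact: measurableC.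
  by apply/seteqP; split => w /=; case: (X k w).
apply/seteqP; split => w /=; first by move=> <- k _ /=; rewrite ffunE.
by move=> h; apply/ffunP => k; rewrite ffunE h.
Qed.

Variables a b : R.
Hypothesis PX : forall k, P [set w | X k w] = a%:E.
Hypothesis PXX : forall k l, k != l -> P [set w | X k w && X l w] = b%:E.

Lemma pair_mass n (k l : 'I_n) :
  \sum_(v : {ffun 'I_n -> bool}) mass P (prefix_vec n) v * (v k && v l)%:R =
  b + (k == l)%:R * (a - b).
Proof.
have := law_pred P (@measurable_prefix_vec n) (fun v => v k && v l).
rewrite [X in P X](_ : _ = [set w | X k w && X l w]); last first.
  by apply/seteqP; split => w /=; rewrite !ffunE.
have -> : P [set w | X k w && X l w] = (b + (k == l)%:R * (a - b))%:E.
  have [->|kl] := eqVneq k l; last by rewrite PXX // mul0r addr0.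
  rewrite mul1r addrC subrK -(PX l); congr (P _).
  by apply/seteqP; split => w /=; rewrite andbb.
move=> [->]; rewrite [RHS]big_mkcond /=; apply: eq_bigr => v _.
by case: (v k && v l); rewrite ?mulr1 ?mulr0.
Qed.

Lemma second_moment n (c : 'I_n -> R) : \sum_k c k = 0 ->
  \sum_(v : {ffun 'I_n -> bool}) mass P (prefix_vec n) v * (\sum_k c k * (v k)%:R) ^+ 2
  = (a - b) * \sum_k c k ^+ 2.
Proof.
move=> c0.
transitivity (\sum_k \sum_l c k * c l * (b + (k == l)%:R * (a - b))).
  under [RHS]eq_bigr do under eq_bigr do rewrite -pair_mass big_distrr /=.
  under [RHS]eq_bigr do rewrite exchange_big /=.
  rewrite [RHS]exchange_big /=; apply: eq_bigr => v _.
  rewrite expr2 big_distrl big_distrr /=; apply: eq_bigr => k _.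
  rewrite big_distrr big_distrr /=; apply: eq_bigr => l _.
  by rewrite -mulnb natrM; ring.
have -> : (a - b) * \sum_k c k ^+ 2 = \sum_k c k ^+ 2 * (a - b) by rewrite mulrC big_distrl.
apply: eq_bigr => k _.
under eq_bigr do rewrite mulrDr.
rewrite big_split /= -big_distrl -big_distrr /= c0 mulr0 mul0r add0r.
rewrite (bigD1 k) //= big1 ?addr0; first by rewrite eqxx mul1r expr2.
by move=> l lk; rewrite eq_sym (negbTE lk) mul0r mulr0.
Qed.

Lemma hits_dist m n (e : R) : (0 < m)%N -> (m <= n)%N -> 0 < e ->
  (P [set w | (e <= (hits n w)%:R / n%:R - (hits m w)%:R / m%:R)%R] <= (m%:R^-1 / e ^+ 2)%:E)%E.
Proof.
move=> m0 mn e0.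
have n0 : (0 < n)%N by exact: leq_trans mn.
pose c (k : 'I_n) : R := n%:R^-1 - (k < m)%N%:R / m%:R.
have cE w : \sum_k c k * (prefix_vec n w k)%:R = (hits n w)%:R / n%:R - (hits m w)%:R / m%:R.
  have -> : hits m w = (\sum_(k < n) (k < m)%N * X k w)%N.
    rewrite /hits (big_ord_widen _ (fun k => X k w : nat) mn) big_mkcond /=.
    by apply: eq_bigr => k _; case: ifP => _; rewrite ?mul1n.
  rewrite /hits !natr_sum !big_distrl /= -sumrB; apply: eq_bigr => k _.
  by rewrite ffunE /c natrM; ring.
have m0R : 0 < m%:R :> R by rewrite ltr0n.
have n0R : 0 < n%:R :> R by rewrite ltr0n.
have sm : \sum_(k < n) (k < m)%N%:R = m%:R :> R.
  rewrite -natr_sum; congr (_%:R).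
  rewrite (eq_bigr (fun k : 'I_n => if (k < m)%N then 1%N else 0%N)); last by move=> k _; case: ifP.
  by rewrite -big_mkcond /= -(big_ord_widen n (fun=> 1%N) mn) sum1_card card_ord.
have c0 : \sum_k c k = 0.
  rewrite sumrB -big_distrl /= sm divff ?gt_eqF // sumr_const card_ord -[_ *+ n]mulr_natr.
  by rewrite mulVf ?gt_eqF // subrr.
have c2 : \sum_k c k ^+ 2 <= m%:R^-1.
  have -> : \sum_k c k ^+ 2 = \sum_(k < n) (n%:R ^- 2 + (k < m)%N%:R * (m%:R ^- 2 - 2%:R / (n%:R * m%:R))).
    apply: eq_bigr => k _; rewrite /c; case: (k < m)%N => /=.
      by field; rewrite !gt_eqF.
    by field; rewrite !gt_eqF.
  rewrite big_split /= -big_distrl /= sm sumr_const card_ord -[_ *+ n]mulr_natr.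
  have -> : n%:R ^- 2 * n%:R + m%:R * (m%:R ^- 2 - 2%:R / (n%:R * m%:R)) = m%:R^-1 - n%:R^-1 :> R.
    by field; rewrite !gt_eqF.
  by rewrite gerBl invr_ge0.
have ab : 0 <= a - b <= 1.
  have mXX : measurable [set w | X 0 w && X 1 w].
    rewrite [X in measurable X](_ : _ = [set w | X 0 w] `&` [set w | X 1 w]).
      exact: measurableI.
    by apply/seteqP; split => w /= => [/andP[]|[-> ->]].
  have b0 : 0 <= b by rewrite -lee_fin -(PXX (isT : 0%N != 1%N)).
  have a1 : a <= 1 by rewrite -lee_fin -(PX 0) probability_le1.
  have ba : b <= a.
    rewrite -lee_fin -(PXX (isT : 0%N != 1%N)) -(PX 0) le_measure ?inE //.
    by move=> w /= /andP[].
  by rewrite subr_ge0 ba lerBlDr (le_trans a1) // lerDl.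
pose Q (v : {ffun 'I_n -> bool}) := e <= \sum_k c k * (v k)%:R.
rewrite [X in P X](_ : _ = [set w | Q (prefix_vec n w)]); last first.
  by apply/seteqP; split => w /=; rewrite /Q cE.
rewrite (law_pred P (@measurable_prefix_vec n)) lee_fin ler_pdivlMr ?exprn_gt0 //.
apply: (@le_trans _ _ ((a - b) * \sum_k c k ^+ 2)); last first.
  case/andP: ab => ab0 ab1.
  apply: le_trans (ler_wpM2r _ ab1) _; last by rewrite mul1r.
  by apply: sumr_ge0 => k _; rewrite sqr_ge0.
rewrite -second_moment // big_distrl /= big_mkcond /=; apply: ler_sum => v _.
have mv := mass_ge0 P (prefix_vec n) v.
rewrite /Q; case: ifP => h; last by rewrite mulr_ge0 // sqr_ge0.
by rewrite ler_wpM2l // lerXn2r ?nnegrE ?(ltW e0) //; apply: le_trans h; exact: ltW.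
Qed.

End ExchangeableSequence.

Lemma invr_natB (R : realType) (j : nat) : 0 < j%:R :> R ->
  j%:R^-1 - j.+1%:R^-1 = (j%:R * j.+1%:R)^-1 :> R.
Proof.
move=> j0; have j1 : 0 < j.+1%:R :> R by rewrite ltr0n.
have e : j.+1%:R = j%:R + 1 :> R by rewrite natr1.
by rewrite e in j1 *; field; rewrite !gt_eqF.
Qed.

Section Density.
Local Open Scope classical_set_scope.
Variable R : realType.
Variable s : nat -> nat.
Hypothesis s0 : s 0 = 0%N.
Hypothesis sS : forall n, (s n <= s n.+1 <= (s n).+1)%N.

Let y n : R := (s n)%:R / n%:R.

Lemma count_mono m n : (m <= n)%N -> (s m <= s n <= s m + (n - m))%N.
Proof.
move=> /subnK <-; elim: (n - m)%N => [|k IH]; first by rewrite add0n subnn addn0 leqnn.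
by have := sS (k + m); rewrite -addSn in IH *; lia.
Qed.

Lemma count_le n : (s n <= n)%N.
Proof. by have := count_mono (leq0n n); rewrite s0 subn0 add0n => /andP[]. Qed.

Lemma density_dist m n : (0 < m)%N -> (m <= n)%N ->
  `|y n - y m| <= 1 - m%:R / n%:R.
Proof.
move=> m0 mn; have /andP[h1 h2] := count_mono mn; have h3 := count_le m.
have m0R : 0 < m%:R :> R by rewrite ltr0n.
have n0R : 0 < n%:R :> R by rewrite ltr0n; exact: leq_trans mn.
have r1 : (s m)%:R <= (s n)%:R :> R by rewrite ler_nat.
have r2 : (s n)%:R + m%:R <= (s m)%:R + n%:R :> R.
  by rewrite -!natrD ler_nat; lia.
have r3 : (s m)%:R <= m%:R :> R by rewrite ler_nat.
have r4 : m%:R <= n%:R :> R by rewrite ler_nat.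
have yn : y n * n%:R = (s n)%:R by rewrite /y divfK // gt_eqF.
have ym : y m * m%:R = (s m)%:R by rewrite /y divfK // gt_eqF.
have ym1 : y m <= 1 by rewrite /y ler_pdivrMr // mul1r.
have ym0 : 0 <= y m by rewrite /y divr_ge0.
have e : 1 - m%:R / n%:R = (n%:R - m%:R) / n%:R :> R by rewrite mulrBl divff // gt_eqF.
rewrite e ler_norml -mulNr ler_pdivrMr // ler_pdivlMr // mulrBl yn -ym in r1 r2 *.
have p1 : 0 <= y m * (n%:R - m%:R) by rewrite mulr_ge0 // subr_ge0.
have p2 : 0 <= (1 - y m) * (n%:R - m%:R) by rewrite mulr_ge0 // subr_ge0.
by apply/andP; split; nra.
Qed.

Let N k := (k.+1 ^ 6)%N.

Lemma grid_gap k n : (N k <= n)%N -> (n <= N k.+1)%N ->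
  1 - (N k)%:R / n%:R <= 6%:R / k.+2%:R :> R.
Proof.
move=> kn nk.
have n0R : 0 < n%:R :> R by rewrite ltr0n (leq_trans _ kn) // expn_gt0.
have Nk0 : 0 < (N k.+1)%:R :> R by rewrite ltr0n expn_gt0.
apply: (@le_trans _ _ (1 - (N k)%:R / (N k.+1)%:R)).
  by rewrite lerD2l lerN2 ler_wpM2l // lef_pV2 ?posrE // ler_nat.
have k2 : 0 < k.+2%:R :> R by rewrite ltr0n.
have -> : (N k)%:R / (N k.+1)%:R = (1 - k.+2%:R^-1) ^+ 6 :> R.
  rewrite /N !natrX -exprVn -exprMn; congr (_ ^+ 6).
  have -> : k.+1%:R = k.+2%:R - 1 :> R by rewrite -[k.+2%:R]natr1 addrK.
  by rewrite mulrBl divff ?gt_eqF // mul1r.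
have i0 : 0 <= k.+2%:R^-1 :> R by rewrite invr_ge0.
have i1 : k.+2%:R^-1 <= 1 :> R by rewrite invf_le1 // ler1n.
move: i0 i1; set z := k.+2%:R^-1 => i0 i1.
have B j : 1 - j%:R * z <= (1 - z) ^+ j.
  elim: j => [|j IH]; first by rewrite mul0r subr0 expr0.
  have z1 : 0 <= 1 - z by rewrite subr_ge0.
  rewrite exprSr; apply: le_trans (ler_wpM2r z1 IH); rewrite -natr1.
  have p : 0 <= j%:R * z * z by rewrite !mulr_ge0.
  by nra.
by have := B 6%N; lra.
Qed.

Lemma grid_index n : (0 < n)%N -> exists k, (N k <= n < N k.+1)%N.
Proof.
move=> n0.
have ex : exists k, (N k <= n)%N by exists 0%N; rewrite /N exp1n.
have ub k : (N k <= n)%N -> (k <= n)%N.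
  apply: leq_trans; apply: leq_trans (leqnSn k) _; rewrite /N.
  by rewrite -{1}(expn1 k.+1) leq_pexp2l.
case: (ex_maxnP ex ub) => k kn kmax; exists k; rewrite kn ltnNge /=.
by apply/negP => /kmax; rewrite ltnn.
Qed.

Lemma N_homo k l : (k <= l)%N -> (N k <= N l)%N.
Proof. by move=> kl; rewrite leq_exp2r // ltnS. Qed.

(* Adding 1/k to the values along the grid makes them nonincreasing, so that an
   upper bound on the increments suffices. *)
Lemma grid_cvg K : (forall k, (K <= k)%N -> y (N k.+1) - y (N k) < k.+1%:R ^- 2) ->
  exists l : R, y (N k) @[k --> \oo] --> l.
Proof.
move=> h.
pose w k := y (N (k + K.+1)) + (k + K.+1)%:R^-1.
have wcv : cvgn w.
  apply: nonincreasing_is_cvgn.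
    apply/nonincreasing_seqP => k; rewrite /w addSn.
    have Kj : (K <= k + K.+1)%N by lia.
    have kp : (0 < k + K.+1)%N by lia.
    move: Kj kp; set j := (k + K.+1)%N => Kj kp.
    have hj := h j Kj.
    have j0 : 0 < j%:R :> R by rewrite ltr0n.
    have j1 : 0 < j.+1%:R :> R by rewrite ltr0n.
    suff q : j.+1%:R ^- 2 <= j%:R^-1 - j.+1%:R^-1 :> R.
      move: (le_trans (ltW hj) q).
      by move: (y _) (y _) j%:R^-1 j.+1%:R^-1 => y1 y0 a b; lra.
    have -> : j%:R^-1 - j.+1%:R^-1 = (j%:R * j.+1%:R)^-1 :> R by exact: invr_natB.
    rewrite lef_pV2 ?posrE ?mulr_gt0 ?exprn_gt0 // expr2 ler_wpM2r ?(ltW j1) //.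
    by rewrite ler_nat.
  exists 0 => _ [k _ <-]; rewrite /w addr_ge0 ?invr_ge0 // /y divr_ge0 //.
exists (limn w); rewrite -(cvg_shiftn K.+1).
rewrite (_ : (fun k => y (N (k + K.+1))) = (fun k => w k - (k + K.+1)%:R^-1)); last first.
  by apply/funext => k; rewrite /w addrK.
rewrite -[limn w]subr0; apply: cvgB => //.
have := @cvg_harmonic R; rewrite -(cvg_shiftn K) => hc.
rewrite [X in X @ \oo --> _](_ : _ = (fun k => harmonic (k + K)%N)) //.
by apply/funext => k; rewrite /harmonic /= addnS.
Qed.

Lemma density_cvg K : (forall k, (K <= k)%N -> y (N k.+1) - y (N k) < k.+1%:R ^- 2) ->
  cvgn y.
Proof.
move=> /grid_cvg[l ycv]; apply/cvg_ex; exists l.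
apply/cvgrPdist_le => e e0.
have e20 : 0 < e / 2%:R by rewrite divr_gt0.
have /cvgrPdist_le/(_ _ e20)[K1 _ hK1] := ycv.
have c6 : 0 <= 12%:R / e by rewrite divr_ge0 // ltW.
pose K2 := maxn K1 (Num.truncn (12%:R / e)).+1.
exists (N K2) => // n /= Kn.
have n0 : (0 < n)%N by apply: leq_trans Kn; rewrite expn_gt0.
have [k /andP[kn nk]] := grid_index n0.
have Kk : (K2 <= k)%N.
  rewrite leqNgt; apply/negP => /N_homo kK.
  by have := leq_ltn_trans (leq_trans kK Kn) nk; rewrite ltnn.
rewrite (_ : l - y n = (l - y (N k)) - (y n - y (N k))); last by rewrite opprB addrA subrK.
apply: (le_trans (ler_normB _ _)); rewrite [leRHS]splitr lerD //.
  by apply: hK1 => /=; apply: leq_trans Kk; exact: leq_maxl.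
apply: (le_trans (density_dist _ kn)); first by rewrite expn_gt0.
apply: (le_trans (grid_gap kn (ltnW nk))).
rewrite ler_pdivrMr ?ltr0n //.
have : 12%:R / e < k.+2%:R.
  apply: (lt_le_trans (truncnS_gt _)); rewrite ler_nat.
  by apply: leq_trans (leqW (leqW Kk)); exact: leq_maxr.
rewrite ltr_pdivrMr // => h; lra.
Qed.

End Density.

Section AlmostSure.
Local Open Scope classical_set_scope.
Variables (d : measure_display) (T : measurableType d) (R : realType).
Variable P : probability T R.
Variable X : nat -> T -> bool.
Hypothesis mX : forall k, measurable [set w | X k w].

Lemma hitsE n w : hits X n w = (\sum_k prefix_vec X n w k)%N.
Proof. by apply: eq_bigr => k _; rewrite ffunE. Qed.

Lemma sum_inv_sqr_le n : \sum_(k < n) (k.+1%:R ^- 2) <= 2%:R :> R.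
Proof.
case: n => [|n]; first by rewrite big_ord0.
suff : \sum_(k < n.+1) (k.+1%:R ^- 2) <= 2%:R - n.+1%:R^-1 :> R.
  by move=> h; apply: le_trans h _; rewrite gerBl invr_ge0.
elim: n => [|n IH]; first by rewrite big_ord1 expr1n invr1; lra.
rewrite big_ord_recr /=; apply: (le_trans (lerD IH (lexx _))).
have j0 : 0 < n.+1%:R :> R by rewrite ltr0n.
have j1 : 0 < n.+2%:R :> R by rewrite ltr0n.
have e : n.+1%:R^-1 - n.+2%:R^-1 = (n.+1%:R * n.+2%:R)^-1 :> R.
  exact: invr_natB.
have : n.+2%:R ^- 2 <= n.+1%:R^-1 - n.+2%:R^-1 :> R.
  rewrite e lef_pV2 ?posrE ?mulr_gt0 ?exprn_gt0 // expr2 ler_wpM2r ?(ltW j1) //.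
  by rewrite ler_nat.
by move: (n.+2%:R ^- 2) (n.+1%:R^-1) (n.+2%:R^-1) => x y z; lra.
Qed.

Lemma hits_density_cvg (a b : R) :
  (forall k, P [set w | X k w] = a%:E) ->
  (forall k l, k != l -> P [set w | X k w && X l w] = b%:E) ->
  {ae P, forall w, cvgn (fun n => (hits X n w)%:R / n%:R : R)}.
Proof.
move=> PX PXX.
pose N k := (k.+1 ^ 6)%N.
pose F k := [set w | (k.+1%:R ^- 2 <= (hits X (N k.+1) w)%:R / (N k.+1)%:R
   - (hits X (N k) w)%:R / (N k)%:R :> R)%R].
have NN k : (N k <= N k.+1)%N by rewrite leq_exp2r.
have hw m n w : (m <= n)%N -> hits X m w = (\sum_(k < n | (k < m)%N) prefix_vec X n w k)%N.
  move=> mn; rewrite /hits (big_ord_widen _ (fun k => X k w : nat) mn).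
  by apply: eq_bigr => k _; rewrite ffunE.
have mF k : measurable (F k).
  pose Q (v : {ffun 'I_(N k.+1) -> bool}) := k.+1%:R ^- 2 <= (\sum_j v j)%N%:R / (N k.+1)%:R
   - (\sum_(j < N k.+1 | (j < N k)%N) v j)%N%:R / (N k)%:R :> R.
  have := measurable_law P (measurable_prefix_vec mX (n := N k.+1)) Q.
  rewrite [X in _ X -> _](_ : _ = F k) //.
  by apply/seteqP; split => w; rewrite /Q /F /= -hitsE (hw _ _ _ (NN k)).
have PF k : (P (F k) <= (k.+1%:R ^- 2)%:E)%E.
  have N0 : (0 < N k)%N by rewrite expn_gt0.
  have e0 : 0 < k.+1%:R ^- 2 :> R by rewrite invr_gt0 exprn_gt0.
  have := hits_dist mX PX PXX N0 (NN k) e0; rewrite -/(F k).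
  rewrite [X in (_ <= X%:E)%E](_ : _ = k.+1%:R ^- 2) //.
  have k0 : k.+1%:R != 0 :> R by rewrite pnatr_eq0.
  by rewrite /N natrX; move: k.+1%:R k0 => z z0; field.
have Z : P (lim_sup_set F) = 0%E.
  apply: lim_sup_set_cvg0 => //.
  apply: (@le_lt_trans _ _ (2%:R : R)%:E); last exact: ltry.
  apply: lime_le; first exact: is_cvg_nneseries.
  apply: nearW => n; rewrite big_mkord.
  apply: (@le_trans _ _ (\sum_(k < n) (k.+1%:R ^- 2)%:E)%E).
    by apply: lee_sum => k _; exact: PF.
  by rewrite sumEFin lee_fin sum_inv_sqr_le.
exists (lim_sup_set F); split => //.
  apply: bigcap_measurable => // k _; apply: bigcup_measurable => j _; exact: mF.
move=> w /= ncv; apply: contrapT => nF; apply: ncv.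
have [K hK] : exists K, forall k, (K <= k)%N -> ~ F k w.
  apply: contrapT => nK; apply: nF => K _; apply: contrapT => nU; apply: nK.
  by exists K => k Kk Fk; apply: nU; exists k.
apply: (@density_cvg R (fun n => hits X n w) _ _ K).
- by rewrite /hits big_ord0.
- by move=> n; rewrite /hits big_ord_recr /=; case: (X n w); rewrite ?addn0 ?addn1 ?leqnn ?leqnSn.
- by move=> k /hK/negP; rewrite -ltNge.
Qed.

Hypothesis sym : forall n c k l, (k < n)%N -> (l < n)%N ->
  P [set w | X k w && (hits X n w <= c)%N] = P [set w | X l w && (hits X n w <= c)%N].

Lemma hit_small_density n c j : (j < n)%N ->
  (P [set w | X j w && (hits X n w <= c)%N] <= (c%:R / n%:R)%:E)%E.
Proof.
move=> jn.
have mp := measurable_prefix_vec mX (n := n).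
pose Q (k : 'I_n) (v : {ffun 'I_n -> bool}) := v k && (\sum_i v i <= c)%N.
have QE (k : 'I_n) : [set w | X k w && (hits X n w <= c)%N] = [set w | Q k (prefix_vec X n w)].
  by apply/seteqP; split => w; rewrite /Q /= -hitsE ffunE.
have n0 : 0 < n%:R :> R by rewrite ltr0n; exact: leq_ltn_trans jn.
pose q := \sum_(v | Q (Ordinal jn) v) mass P (prefix_vec X n) v.
have Pq : P [set w | X j w && (hits X n w <= c)%N] = q%:E.
  by rewrite (QE (Ordinal jn)) law_pred.
rewrite Pq lee_fin ler_pdivlMr //.
have -> : q * n%:R = \sum_(k < n) \sum_(v | Q k v) mass P (prefix_vec X n) v.
  rewrite (eq_bigr (fun=> q)); first by rewrite sumr_const card_ord mulr_natr.
  move=> k _; have := sym c (ltn_ord k) jn; rewrite Pq QE law_pred //.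
  by move=> [].
under eq_bigr do rewrite big_mkcond /=.
rewrite exchange_big /=.
apply: (@le_trans _ _ (\sum_v mass P (prefix_vec X n) v * c%:R)); last first.
  by rewrite -big_distrl /= sum_mass // mul1r.
apply: ler_sum => v _.
have mv := mass_ge0 P (prefix_vec X n) v.
rewrite /Q; have [h|h] := leqP (\sum_i v i) c; last first.
  by rewrite big1 ?mulr_ge0 // => k _; rewrite andbF.
under eq_bigr do rewrite andbT.
rewrite (_ : \sum_(k < n) _ = mass P (prefix_vec X n) v * (\sum_i v i)%N%:R).
  by rewrite ler_wpM2l // ler_nat.
rewrite natr_sum big_distrr /=; apply: eq_bigr => k _.
by case: (v k); rewrite ?mulr1 ?mulr0.
Qed.

Lemma hit_pos_density j :
  {ae P, forall w, X j w -> ~ ((hits X n w)%:R / n%:R : R) @[n --> \oo] --> (0 : R)}.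
Proof.
pose G q n := [set w | X j w && (hits X n w <= n %/ q.+1)%N].
have mG q n : measurable (G q n).
  have m1 := mX j.
  have m2 := measurable_law P (measurable_prefix_vec mX (n := n)) (fun v => (\sum_i v i <= n %/ q.+1)%N).
  rewrite [X in measurable X](_ : _ = [set w | X j w] `&` [set w | (\sum_i prefix_vec X n w i <= n %/ q.+1)%N]).
    exact: measurableI.
  apply/seteqP; split => w; rewrite /G /= -hitsE; first by move=> /andP[].
  by move=> [-> ->].
pose H q M := \bigcap_(n >= M) G q n.
have mH q M : measurable (H q M) by apply: bigcap_measurable => [|n _]; [exists M => /=|exact: mG].
have PH q M : (P (H q M) <= (q.+1%:R^-1)%:E)%E.
  pose n := maxn M j.+1.
  have jn : (j < n)%N by exact: leq_maxr.
  apply: (@le_trans _ _ (P (G q n))).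
    rewrite le_measure ?inE //; apply: bigcap_inf; exact: leq_maxl.
  apply: (le_trans (hit_small_density _ jn)); rewrite lee_fin.
  rewrite ler_pdivrMr; last by rewrite ltr0n; exact: leq_ltn_trans jn.
  by rewrite ler_pdivlMl ?ltr0n // -natrM ler_nat mulnC leq_divM.
pose U q := \bigcup_M H q M.
have mU q : measurable (U q) by apply: bigcup_measurable.
have PU q : (P (U q) <= (q.+1%:R^-1)%:E)%E.
  have cv : P \o H q @ \oo --> P (U q).
    apply: nondecreasing_cvg_mu => //; first exact: mU.
    apply/nondecreasing_seqP => M; apply/subsetPset => w Hw n /= Mn.
    by apply: Hw => /=; exact: ltnW.
  by apply: cvge_le cv; apply: nearW => M; exact: PH.
exists (\bigcap_q U q); split.
- by apply: bigcap_measurable => // q _; exact: mU.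
- apply/eqP; rewrite eq_le measure_ge0 andbT.
  apply/lee_addgt0Pr => e e0; rewrite add0e.
  pose q := Num.truncn e^-1.
  apply: (@le_trans _ _ (P (U q))).
    rewrite le_measure ?inE //; last exact: bigcap_inf.
    by apply: bigcap_measurable => // r _; exact: mU.
  apply: (le_trans (PU q)); rewrite lee_fin invf_ple ?posrE ?ltr0n //.
  by rewrite ltW // truncnS_gt.
- move=> w /= /not_implyP[Xw /contrapT cv] q _.
  have q0 : 0 < q.+1%:R^-1 :> R by rewrite invr_gt0 ltr0n.
  have /cvgrPdist_le/(_ _ q0)[M _ hM] := cv.
  exists M.+1 => // n /= Mn; rewrite /G /= Xw /=.
  have n0 : (0 < n)%N by exact: leq_ltn_trans Mn.
  have := hM n (ltnW Mn); rewrite /= sub0r normrN ger0_norm ?divr_ge0 //.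
  rewrite ler_pdivrMr ?ltr0n // ler_pdivlMl ?ltr0n // -natrM ler_nat => h.
  by rewrite leq_divRL // mulnC.
Qed.

End AlmostSure.

(** * The coalescent *)

Local Open Scope classical_set_scope.

Section Coalescent.
Variables (R : realType) (Lam : {finite_measure set R -> \bar R}).
Variables (d : measure_display) (T : measurableType d) (P : probability T R).
Variable Pi : R -> T -> nat -> nat -> bool.
Hypothesis HC : is_Lambda_coalescent Lam P Pi.

Lemma coalescent_equiv t w : 0 <= t -> equivalence_rel (Pi t w).
Proof. by case: HC => h _; exact: h. Qed.

Lemma measurable_restr t n pi : 0 <= t -> measurable [set w | restr n (Pi t w) = pi].
Proof. by case: HC => _ [h _]; exact: h. Qed.

Lemma restr_law n t pi : 0 <= t ->
  P [set w | restr n (Pi t w) = pi] = (ptrans Lam t (singletons_n n) pi)%:E.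
Proof.
move=> t0; have [_ [_ fdd]] := HC.
pose A0 := [set w | restr n (Pi 0 w) = singletons_n n].
pose A1 := [set w | restr n (Pi t w) = pi].
have mA0 : measurable A0 by exact: measurable_restr.
have mA1 : measurable A1 by exact: measurable_restr.
have PA0 : P A0 = 1%E.
  have := fdd n 0%N (fun=> 0) (fun=> singletons_n n) erefl erefl.
  rewrite big_ord0 [X in P X](_ : _ = A0); first by apply.
  apply/seteqP; split => w /=; first by move=> /(_ 0%N); apply.
  by move=> h i _.
have := fdd n 1%N (fun i => if i is 0 then 0 else t)
  (fun i => if i is 0 then singletons_n n else pi) erefl erefl.
rewrite big_ord1 subr0 => <-; last by case.
rewrite [X in _ = P X](_ : _ = A1 `&` A0); last first.
  apply/seteqP; split => w /=.
    by move=> h; split; [apply: (h 1%N)|apply: (h 0%N)].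
  by move=> [h1 h0] [|[|i]].
have Z : P (A1 `\` A0) = 0%E.
  apply/eqP; rewrite eq_le measure_ge0 andbT.
  have <- : P (~` A0) = 0%E by rewrite probability_setC // PA0 subee.
  rewrite le_measure ?inE //; first exact: measurableD.
  exact: measurableC.
transitivity (P (A1 `\` A0) + P (A1 `&` A0))%E; first exact: measureDI.
by rewrite Z add0e.
Qed.

Lemma mass_restr n t pi : 0 <= t ->
  mass P (fun w => restr n (Pi t w)) pi = ptrans Lam t (singletons_n n) pi.
Proof. by move=> t0; rewrite /mass restr_law. Qed.

Lemma ptrans_row n u : 0 <= u ->
  [/\ forall pi, 0 <= ptrans Lam u (singletons_n n) pi,
      \sum_pi ptrans Lam u (singletons_n n) pi = 1 &
      forall pi, ~~ finset.partition pi [set: 'I_n]%SET ->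
        ptrans Lam u (singletons_n n) pi = 0].
Proof.
move=> u0; have mr pi := @measurable_restr u n pi u0; split.
- by move=> pi; rewrite -mass_restr //; exact: mass_ge0.
- by under eq_bigr do rewrite -mass_restr //; rewrite sum_mass.
- move=> pi npi; rewrite -mass_restr // /mass.
  rewrite (_ : [set w | _] = set0) ?measure0 //; apply/seteqP; split => // w /= e.
  by move/negP: npi; apply; rewrite -e; apply: partition_restr; exact: coalescent_equiv.
Qed.

Lemma restr_event n t (Q : pred (fstate n)) : 0 <= t ->
  P [set w | Q (restr n (Pi t w))] = (chain_mean Lam (singletons_n n) (fun s => (Q s)%:R) t)%:E.
Proof.
move=> t0; rewrite law_pred; last by move=> pi; exact: measurable_restr.
rewrite chain_meanE big_mkcond /=; congr (_%:E); apply: eq_bigr => pi _.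
by rewrite mass_restr //; case: (Q pi); rewrite ?mulr1 ?mulr0.
Qed.

Lemma restr_exchangeable n t (s : {perm 'I_n}) (Q : pred (fstate n)) : 0 <= t ->
  P [set w | Q (restr n (Pi t w))] = P [set w | Q (relabel s (restr n (Pi t w)))].
Proof.
move=> t0; rewrite restr_event // (restr_event (fun pi => Q (relabel s pi))) // !chain_meanE.
congr (_%:E).
rewrite (reindex (relabel s)) /=; last exact/onW_bij/relabel_bij.
by apply: eq_bigr => pi _; rewrite ptrans_relabel.
Qed.

Lemma coalescent_exchangeable n t (s : {perm 'I_n}) (Q : ('I_n -> 'I_n -> bool) -> bool) :
  0 <= t ->
  P [set w | Q (fun i j => Pi t w i j)] = P [set w | Q (fun i j => Pi t w (s i) (s j))].
Proof.
move=> t0; have lE w : linked (restr n (Pi t w)) = (fun i j => Pi t w i j).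
  by apply/funext => i; apply/funext => j; rewrite linked_restr //; exact: coalescent_equiv.
have := restr_exchangeable s^-1 (fun pi => Q (linked pi)) t0.
rewrite [X in P X = _ -> _](_ : _ = [set w | Q (fun i j => Pi t w i j)]); last first.
  by apply/seteqP; split => w /=; rewrite lE.
move=> ->; congr (P _); apply/seteqP.
have rE w : linked (relabel s^-1 (restr n (Pi t w))) = (fun i j => Pi t w (s i) (s j)).
  apply/funext => i; apply/funext => j.
  by rewrite -{1}(permK s i) -{1}(permK s j) linked_relabel lE.
by split => w /=; rewrite rE.
Qed.

Section FixedBlock.
Variables (t : R) (i : nat).
Hypothesis t0 : 0 <= t.

Definition others (k : nat) (w : T) : bool := Pi t w i (bump i k).

Lemma measurable_others k : measurable [set w | others k w].
Proof.
pose n := (i + k).+2.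
have hi : (i < n)%N by rewrite /n; lia.
have hk : (bump i k < n)%N by rewrite /n /bump; lia.
have := measurable_law P (fun pi => @measurable_restr t n pi t0)
  (fun pi => linked pi (Ordinal hi) (Ordinal hk)).
rewrite [X in _ X -> _](_ : _ = [set w | others k w]) //.
by apply/seteqP; split => w /=; rewrite linked_restr //; exact: coalescent_equiv.
Qed.

Lemma others_swap n (k l : 'I_n) (Q : {ffun 'I_n -> bool} -> bool) :
  P [set w | Q (prefix_vec others n w)] =
  P [set w | Q [ffun m => prefix_vec others n w (tperm k l m)]].
Proof.
pose N := (i + n)%N.
have iN : (i < N.+1)%N by rewrite /N; lia.
have bN (m : 'I_n) : (bump i m < N.+1)%N by rewrite /N /bump; have := ltn_ord m; lia.
pose oi := Ordinal iN; pose ob m := Ordinal (bN m).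
have obi m : ob m != oi by rewrite -val_eqE /= eq_sym neq_bump.
have ob_inj : injective ob.
  by move=> x y /(congr1 val) /= /(can_inj (bumpK i)) xy; exact: val_inj.
pose s := tperm (ob k) (ob l).
have si : s oi = oi by rewrite tpermD // obi.
have sb m : s (ob m) = ob (tperm k l m).
  have [->|->|mk ml] := tpermP; first by rewrite /s tpermL.
    by rewrite /s tpermR.
  rewrite /s tpermD //.
    by apply/eqP => /ob_inj; exact/nesym.
  by apply/eqP => /ob_inj; exact/nesym.
have := @coalescent_exchangeable N.+1 t s (fun r => Q [ffun m => r oi (ob m)]) t0.
rewrite [X in P X = _ -> _](_ : _ = [set w | Q (prefix_vec others n w)]); last by [].
move=> ->; congr (P _); apply/seteqP.
have e w : [ffun m => Pi t w (s oi) (s (ob m))] =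
   [ffun m => prefix_vec others n w (tperm k l m)].
  by apply/ffunP => m; rewrite !ffunE si sb.
by split => w /=; rewrite e.
Qed.

Lemma others_pair k l : P [set w | others k w] = P [set w | others l w].
Proof.
pose n := (k + l).+1.
have hk : (k < n)%N by rewrite /n; lia.
have hl : (l < n)%N by rewrite /n; lia.
have := others_swap (Ordinal hk) (Ordinal hl) (fun v => v (Ordinal hk)).
rewrite [X in P X = _ -> _](_ : _ = [set w | others k w]); last first.
  by apply/seteqP; split => w /=; rewrite ffunE.
move=> ->; congr (P _); apply/seteqP.
by split => w /=; rewrite !ffunE tpermL.
Qed.

Lemma others_triple k l l' : l != k -> l' != k ->
  P [set w | others k w && others l w] = P [set w | others k w && others l' w].
Proof.
move=> lk l'k; pose n := (k + l + l').+1.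
have hk : (k < n)%N by rewrite /n; lia.
have hl : (l < n)%N by rewrite /n; lia.
have hl' : (l' < n)%N by rewrite /n; lia.
have := others_swap (Ordinal hl) (Ordinal hl') (fun v => v (Ordinal hk) && v (Ordinal hl)).
rewrite [X in P X = _ -> _](_ : _ = [set w | others k w && others l w]); last first.
  by apply/seteqP; split => w /=; rewrite !ffunE.
move=> ->; congr (P _); apply/seteqP.
by split => w /=; rewrite !ffunE tpermL tpermD.
Qed.

Lemma others_pairs k l : k != l ->
  P [set w | others k w && others l w] = P [set w | others 0 w && others 1 w].
Proof.
move=> kl.
have C a b : P [set w | others a w && others b w] = P [set w | others b w && others a w].
  by congr (P _); apply/seteqP; split => w /=; rewrite andbC.
have [k0|k0] := eqVneq k 0%N.
  by rewrite k0; apply: others_triple => //; rewrite -k0 eq_sym.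
rewrite (@others_triple k l 0%N) // ?[_ == k]eq_sym // C.
by apply: others_triple.
Qed.

Lemma others_sym n c k l : (k < n)%N -> (l < n)%N ->
  P [set w | others k w && (hits others n w <= c)%N] =
  P [set w | others l w && (hits others n w <= c)%N].
Proof.
move=> hk hl.
have := others_swap (Ordinal hk) (Ordinal hl)
  (fun v => v (Ordinal hk) && (\sum_m v m <= c)%N).
rewrite [X in P X = _ -> _](_ : _ = [set w | others k w && (hits others n w <= c)%N]); last first.
  by apply/seteqP; split => w /=; rewrite -hitsE ffunE.
move=> ->; congr (P _); apply/seteqP.
have e w : (\sum_m [ffun m => prefix_vec others n w (tperm (Ordinal hk) (Ordinal hl) m)] m)%N
   = hits others n w.
  rewrite hitsE [RHS](reindex_inj (@perm_inj _ (tperm (Ordinal hk) (Ordinal hl)))) /=.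
  by apply: eq_bigr => m _; rewrite ffunE.
by split => w /=; rewrite e !ffunE tpermL.
Qed.

Lemma count_block w n : (i <= n)%N ->
  #|[set j : 'I_n.+1 | `[< [set k | Pi t w i k]%classic (val j) >]]%SET| = (hits others n w).+1.
Proof.
move=> ni; rewrite -sum1_card big_mkcond /=.
rewrite (eq_bigr (fun j : 'I_n.+1 => Pi t w i j : nat)); last first.
  by move=> j _; rewrite inE /=; case: ifPn => [/asboolP ->|/asboolP/negP/negbTE ->].
rewrite (bigD1_ord (Ordinal (ni : (i < n.+1)%N))) //=.
by have [-> _] := coalescent_equiv w t0 i i i.
Qed.

Lemma nonsingleton_block_pos_freq :
  {ae P, forall w, forall j, j != i -> Pi t w i j -> pos_freq R [set k | Pi t w i k]}.
Proof.
have cv : {ae P, forall w, cvgn (fun n => (hits others n w)%:R / n%:R : R)}.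
  apply: (@hits_density_cvg _ _ _ P _ measurable_others
    (fine (P [set w | others 0 w])) (fine (P [set w | others 0 w && others 1 w]))).
    move=> k; rewrite fineK; first exact: others_pair.
    by apply: fin_num_measure; exact: measurable_others.
  move=> k l kl; rewrite fineK; first exact: others_pairs.
  apply: fin_num_measure; rewrite (_ : [set w | _] = [set w | others 0 w] `&` [set w | others 1 w]).
    by apply: measurableI; exact: measurable_others.
  by apply/seteqP; split => w /= => [/andP[]|[-> ->]].
have ps : {ae P, forall w, forall j, others j w ->
    ~ ((hits others n w)%:R / n%:R : R) @[n --> \oo] --> (0 : R)}.
  apply: ae_foralln => j; apply: hit_pos_density; first exact: measurable_others.
  exact: others_sym.
apply: filterS2 cv ps => w cvw psw j ji ij.
have oj : others (unbump i j) w by rewrite /others unbumpKcond (negbTE ji) add0n.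
set y := (fun n => _) in cvw.
exists (limn y).
  rewrite lt_neqAle; apply/andP; split.
    by apply/eqP => l0; apply: (psw _ oj); rewrite l0.
  by apply: limr_ge => //; apply: nearW => n; rewrite divr_ge0.
rewrite -cvg_shiftS.
have h0 := @cvg_harmonic R.
have h1 : (1 - harmonic n : R) @[n --> \oo] --> (1 - 0 : R).
  by apply: cvgB => //; exact: cvg_cst.
have lim1 : y n * (1 - harmonic n) + harmonic n @[n --> \oo] --> limn y.
  rewrite -[limn y]addr0 -{1}[limn y]mulr1 -[X in limn y * X](subr0 1).
  by apply: cvgD => //; apply: cvgM.
apply: cvg_trans lim1; apply: near_eq_cvg; exists i => // n /= ni.
rewrite count_block // /y /harmonic /=.
have n1 : n.+1%:R != 0 :> R by rewrite pnatr_eq0.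
case: n ni n1 => [|n] ni n1; first by rewrite invr0 mulr0 mul0r add0r /hits big_ord0 invr1 mulr1.
have n0 : n.+1%:R != 0 :> R by rewrite pnatr_eq0.
have -> : 1 - n.+2%:R^-1 = n.+1%:R / n.+2%:R :> R.
  have -> : n.+1%:R = n.+2%:R - 1 :> R by rewrite -[n.+2%:R]natr1 addrK.
  by rewrite mulrBl divff // mul1r.
by rewrite mulrA divfK // -[(hits _ _ _).+1%:R]natr1 mulrDl mul1r.
Qed.

End FixedBlock.

Lemma Na_infinite_of_blocks t w : 0 <= t ->
  (forall i j, j != i -> Pi t w i j -> pos_freq R [set k | Pi t w i k]) ->
  (forall m, exists n, (m < #|large_blocks (restr n (Pi t w))|)%N) ->
  Na_infinite R (Pi t w).
Proof.
move=> t0 pf many; have eqv := coalescent_equiv w t0.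
have refl x : Pi t w x x by have [] := eqv x x x.
have tr x y z : Pi t w x y -> Pi t w x z = Pi t w y z by have [_] := eqv x y z.
rewrite /Na_infinite => /finite_seqP[s sE].
have [n] := many (size s); apply/negP; rewrite -leqNgt.
pose g (b : set nat) : {set 'I_n} := [set j : 'I_n | `[< b (val j) >]]%SET.
rewrite cardE -(size_map g s); apply: uniq_leq_size; first exact: enum_uniq.
move=> C; rewrite mem_enum inE => /andP[/imsetP[i _ CE] C1].
have iC : i \in C by rewrite CE inE refl.
have [j jC ji] : exists2 j, j \in C & j != i.
  move: C1 => /card_gt1P[x [y [xC yC xy]]].
  by have [xi|xi] := eqVneq x i; [exists y => //; rewrite -xi eq_sym|exists x].
have bs : [set` s] [set k | Pi t w i k].
  rewrite -sE; split; first by exists i.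
  by apply: (pf i j) => //; move: jC; rewrite CE inE.
apply/mapP; exists [set k | Pi t w i k] => //.
rewrite CE; apply/setP => x; rewrite !inE /=.
by apply/idP/asboolP.
Qed.

End Coalescent.

Lemma atom0_eq0 (R : realType) (Lam : {finite_measure set R -> \bar R}) :
  nu Lam ([set 0] `|` [set 1]) = 0%E -> Lam [set 0] = 0%E.
Proof.
move=> nu0; apply/eqP; apply: contraT => L0.
have Lp : (0 < Lam [set 0%R])%E by rewrite lt_neqAle eq_sym L0 measure_ge0.
suff : (+oo <= nu Lam ([set 0%R] `|` [set 1%R]))%E by rewrite nu0.
apply: (@le_trans _ _ (\int[Lam]_(x in [set 0%R]) dens2 x)%E).
  rewrite (eq_integral (cst +oo%E)); last first.
    by move=> x; rewrite inE /= => ->; rewrite /dens2 eqxx.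
  by rewrite integral_cst // gt0_mulye.
apply: ge0_subset_integral => //.
- exact: measurableU.
- by apply/measurable_funU => //; split; exact: measurable_fun_set1.
- by move=> x _; exact: dens2_ge0.
Qed.

Theorem theorem5 (R : realType) (Lam : {finite_measure set R -> \bar R})
  (d : measure_display) (T : measurableType d) (P : probability T R)
  (Pi : R -> T -> nat -> nat -> bool) :
  Lam (~` `[0%R, 1%R]) = 0%E ->
  Lam [set 1] = 0%E ->
  nu Lam ([set 0] `|` [set 1]) = 0%E ->
  (nu_first_moment Lam < +oo)%E ->
  nu Lam `[0%R, 1%R] = +oo%E ->
  is_Lambda_coalescent Lam P Pi ->
  forall t : R, 0 < t ->
    {ae P, forall w, Na_infinite R (Pi t w)}.
Proof.
move=> _ Lam1 /atom0_eq0 Lam0 mom nuoo HC t t0.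
have t0' := ltW t0.
have freq : {ae P, forall w, forall i j, j != i -> Pi t w i j ->
    pos_freq R [set k | Pi t w i k]}.
  by apply: ae_foralln => i; exact: nonsingleton_block_pos_freq HC _ _ t0'.
have many : {ae P, forall w, forall m, exists n, (m < #|large_blocks (restr n (Pi t w))|)%N}.
  apply: ae_foralln => m.
  pose F n := [set w | (#|large_blocks (restr n (Pi t w))| <= m)%N].
  have mF n : measurable (F n).
    exact: (measurable_law P (fun pi => @measurable_restr _ _ _ _ _ _ HC t n pi t0')
      (fun pi => (#|large_blocks pi| <= m)%N)).
  exists (\bigcap_n F n); split.
  - by apply: bigcap_measurable => // n _; exact: mF.
  - apply/eqP; rewrite eq_le measure_ge0 andbT.
    apply/lee_addgt0Pr => e e0; rewrite add0e.
    have [N hN] := few_blocks_unlikely Lam0 Lam1 mom (ptrans_row HC) m nuoo t0 e0.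
    apply: (@le_trans _ _ (P (F N))).
      rewrite le_measure ?inE //; last exact: bigcap_inf.
      by apply: bigcap_measurable => // n _; exact: mF.
    by rewrite /F (restr_event HC (fun pi => (#|large_blocks pi| <= m)%N)) // lee_fin hN.
  - move=> w /= h n _; rewrite /F /= leqNgt; apply/negP => h2; apply: h.
    by exists n.
by apply: filterS2 freq many => w; exact: Na_infinite_of_blocks HC _ _ t0'.
Qed.
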